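(* Let $\mathfrak{X}$ be a Banach space that fails the complete continuity property. Then for every $\varepsilon>0$ there is a closed subspace $\mathfrak{X}_0$ of $\mathfrak{X}$ such that $\mathfrak{X}_0$ has a finite dimensional decomposition with constant at most $1+\varepsilon$ and $\mathfrak{X}_0$ fails the complete continuity property.
   Context: Scalars are real. $L_1$ is the space $L_1[0,1]$ with respect to Lebesgue measure. A bounded linear operator is completely continuous if it maps weakly convergent sequences to norm convergent sequences. A Banach space $\mathfrak{X}$ has the complete continuity property (CCP) if each bounded linear operator from $L_1$ into $\mathfrak{X}$ is completely continuous. A sequence $\{\mathfrak{X}_j\}$ of finite dimensional subspaces (zero subspaces allowed) of a Banach space $\mathfrak{X}_0$ is a finite dimensional decomposition of $\mathfrak{X}_0$ if each $x\in\mathfrak{X}_0$ has a unique norm convergent expansion $x=\sum_j x_j$ with $x_j\in\mathfrak{X}_j$; its constant is the supremum over $n$ of the norms of the partial sum projections $\sum_j x_j\mapsto\sum_{j\le n}x_j$. *)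

(* Defs.v *)
From HB Require Import structures.
From mathcomp Require Import all_boot all_order all_algebra.
From mathcomp Require Import all_classical all_reals all_analysis.
From mathcomp Require Import measurable_realfun ess_sup_inf.

Set Implicit Arguments.
Unset Strict Implicit.
Unset Printing Implicit Defensive.

Import Order.TTheory GRing.Theory Num.Theory.
Import numFieldNormedType.Exports.

Local Open Scope classical_set_scope.
Local Open Scope ring_scope.

(* The library's LspaceType is the set of a.e.-classes of functions with finite
   L^p-norm; it is equipped here with its normed space structure. *)
Section Lspace_normed.
Context d (T : measurableType d) (R : realType).
Variables (mu : {measure set T -> \bar R}) (p : \bar R) (p1 : (1 <= p)%E).

Local Notation Lsp := (LspaceType mu p1).
Local Notation Lf := (LfunType mu p1).
Implicit Types (F G H : Lsp) (f g h : Lf).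

HB.instance Definition _ := gen_eqMixin (LspaceType mu p1).
HB.instance Definition _ := gen_choiceMixin (LspaceType mu p1).

Lemma eq_ae_Lnorm (u v : T -> R) :
  measurable_fun setT u -> measurable_fun setT v -> u = v %[ae mu] ->
  'N[mu]_p[EFin \o u]%E = 'N[mu]_p[EFin \o v]%E.
Proof.
move=> mu_ mv uv; rewrite unlock; case: p p1 => [r _|_|//].
- have mpow (w : T -> R) : measurable_fun setT w ->
      measurable_fun setT (fun x => `|(EFin \o w) x| `^ r)%E.
    move=> mw; apply: (measurableT_comp (measurable_poweR _)).
    by apply: measurableT_comp => //; exact/measurable_EFinP.
  congr (_ `^ _)%E; apply: ae_eq_integral; [by []|exact: mpow|exact: mpow|].
  by apply: filterS uv => x /= /[apply] ->.
- case: ifP => // _; apply: eq_ess_sup.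
  by apply: filterS uv => x /= /(_ I) ->.
Qed.

Lemma Lspace_repr_subproof F :
  (repr (LebesgueSpace.sort F) : T -> R) \in Lfun mu p.
Proof.
apply/andP; split; rewrite inE.
  exact: (@measurable_funPT _ _ _ _ (repr (LebesgueSpace.sort F))).
exact: (@Lebesgue_finite _ _ _ _ _ _ F).
Qed.

Definition Lspace_repr F : Lf := Lfun_Sub p1 (Lspace_repr_subproof F).

Definition Lfun_mfun f : {mfun T >-> measurableTypeR R} :=
  HB.pack_for {mfun T >-> measurableTypeR R} (f : T -> R)
    (@isMeasurableFun.Build _ _ T (measurableTypeR R) f (measurable_funPT f)).

Definition Lfun_quot f : {mfun_ mu, T >-> measurableTypeR R} :=
  \pi_({mfun_ mu, T >-> measurableTypeR R})%qT (Lfun_mfun f).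

Lemma Lfun_quotE f : (Lfun_quot f : T -> R) = f %[ae mu].
Proof.
have /eqP : (repr (Lfun_quot f)
   = Lfun_mfun f %[mod {mfun_ mu, T >-> measurableTypeR R}])%qT by rewrite reprK.
by rewrite eqmodE => /asboolP.
Qed.

Lemma Lfun_quot_finite f : finite_norm mu p (Lfun_quot f : T -> R).
Proof.
have qP : measurable_fun setT (Lfun_quot f : T -> R).
  exact: (@measurable_funPT _ _ _ _ (repr (Lfun_quot f))).
have := Lfunction_finite p1 f; rewrite /finite_norm.
suff -> : 'N[mu]_p[EFin \o f]%E = 'N[mu]_p[EFin \o (Lfun_quot f : T -> R)]%E.
  by [].
by apply: eq_ae_Lnorm => //; exact: ae_eq_sym (Lfun_quotE f).
Qed.

Definition Lclass f : Lsp :=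
  HB.pack_for Lsp (Lfun_quot f) (@isFinLebesgue.Build _ _ _ _ _ p1 (Lfun_quot f)
    (Lfun_quot_finite f)).

Lemma Lspace_reprK f : (Lspace_repr (Lclass f) : T -> R) = f %[ae mu].
Proof. exact: Lfun_quotE. Qed.

Lemma Lspace_eqP F G :
  F = G <-> (Lspace_repr F : T -> R) = Lspace_repr G %[ae mu].
Proof.
split=> [->|FG]; first exact: ae_eq_refl.
have : LebesgueSpace.sort F = LebesgueSpace.sort G.
  by rewrite -[LHS]reprK -[RHS]reprK; apply/eqP; rewrite eqmodE; exact/asboolP.
case: F G FG => [F [[Fp]]] [G [[Gp]]] /= _ FG.
by case: _ / FG Gp => Gp; rewrite (Prop_irrelevance Fp Gp).
Qed.

Lemma Lclass_eqP f g : Lclass f = Lclass g <-> (f : T -> R) = g %[ae mu].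
Proof.
rewrite Lspace_eqP; split=> fg.
  by apply: ae_eq_trans (Lspace_reprK g); apply: ae_eq_trans fg;
    exact: ae_eq_sym (Lspace_reprK f).
by apply: ae_eq_trans (ae_eq_sym (Lspace_reprK g)); apply: ae_eq_trans fg;
  exact: Lspace_reprK f.
Qed.

Lemma Lclass_repr F : Lclass (Lspace_repr F) = F.
Proof. by apply/Lspace_eqP; exact: Lspace_reprK. Qed.

Definition Lspace_add F G := Lclass (Lspace_repr F + Lspace_repr G).
Definition Lspace_opp F := Lclass (- Lspace_repr F).
Definition Lspace_scale (a : R) F := Lclass (a *: Lspace_repr F).

Lemma LclassD f g : Lspace_add (Lclass f) (Lclass g) = Lclass (f + g).
Proof.
apply/Lclass_eqP; apply: filterS2 (Lspace_reprK f) (Lspace_reprK g) => x fx gx _.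
by congr (_ + _); [exact: fx|exact: gx].
Qed.

Lemma LclassN f : Lspace_opp (Lclass f) = Lclass (- f).
Proof.
apply/Lclass_eqP; apply: filterS (Lspace_reprK f) => x fx _.
by congr (- _); exact: fx.
Qed.

Lemma LclassZ a f : Lspace_scale a (Lclass f) = Lclass (a *: f).
Proof.
apply/Lclass_eqP; apply: filterS (Lspace_reprK f) => x fx _.
by congr (_ * _); exact: fx.
Qed.

Lemma Lspace_addA : associative Lspace_add.
Proof.
move=> F G H; rewrite -[F]Lclass_repr -[G]Lclass_repr -[H]Lclass_repr.
by rewrite !LclassD addrA.
Qed.

Lemma Lspace_addC : commutative Lspace_add.
Proof. by move=> F G; rewrite /Lspace_add addrC. Qed.

Lemma Lspace_add0 : left_id (Lclass 0) Lspace_add.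
Proof. by move=> F; rewrite -[F]Lclass_repr LclassD add0r. Qed.

Lemma Lspace_addN : left_inverse (Lclass 0) Lspace_opp Lspace_add.
Proof. by move=> F; rewrite -[F]Lclass_repr LclassN LclassD addNr. Qed.

HB.instance Definition _ := GRing.isZmodule.Build (LspaceType mu p1)
  Lspace_addA Lspace_addC Lspace_add0 Lspace_addN.

Lemma Lspace_scaleA a b F :
  Lspace_scale a (Lspace_scale b F) = Lspace_scale (a * b) F.
Proof. by rewrite -[F]Lclass_repr !LclassZ scalerA. Qed.

Lemma Lspace_scale1 : left_id 1 Lspace_scale.
Proof. by move=> F; rewrite -[F]Lclass_repr LclassZ scale1r. Qed.

Lemma Lspace_scaleDr : right_distributive Lspace_scale +%R.
Proof.
move=> a F G; rewrite -[F]Lclass_repr -[G]Lclass_repr.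
by rewrite [in LHS]/GRing.add/= [in RHS]/GRing.add/= LclassD !LclassZ LclassD scalerDr.
Qed.

Lemma Lspace_scaleDl F : {morph Lspace_scale^~ F : a b / a + b}.
Proof.
by move=> a b; rewrite -[F]Lclass_repr /= !LclassZ [RHS]LclassD scalerDl.
Qed.

HB.instance Definition _ := GRing.Zmodule_isLmodule.Build R (LspaceType mu p1)
  Lspace_scaleA Lspace_scale1 Lspace_scaleDr Lspace_scaleDl.

Definition Lspace_norm F : R := fine 'N[mu]_p[EFin \o Lspace_repr F]%E.

Lemma Lspace_normE f : Lspace_norm (Lclass f) = fine 'N[mu]_p[EFin \o f]%E.
Proof. by congr fine; apply: eq_ae_Lnorm => //; exact: Lspace_reprK. Qed.

Lemma ler_Lspace_normD F G : Lspace_norm (F + G) <= Lspace_norm F + Lspace_norm G.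
Proof. by rewrite [X in X <= _]Lspace_normE; exact: ler_LnormD. Qed.

Lemma Lspace_normZ a F : Lspace_norm (a *: F) = `|a| * Lspace_norm F.
Proof.
rewrite [LHS]Lspace_normE; apply: EFin_inj.
rewrite finite_norm_fine EFinM finite_norm_fine.
exact: LnormZ.
Qed.

Lemma Lspace_norm_eq0 F : Lspace_norm F = 0 -> F = 0.
Proof.
move=> /fine_Lnormr_eq0 F0; rewrite -[F]Lclass_repr.
exact/Lclass_eqP.
Qed.

HB.instance Definition _ := Lmodule_isNormed.Build R (LspaceType mu p1)
  ler_Lspace_normD Lspace_normZ Lspace_norm_eq0.

End Lspace_normed.

Section L1_unit_interval.
Variable R : realType.

(* Lebesgue measure restricted to [0,1]: its a.e.-classes consist of functions
   defined on the whole line that agree a.e. on [0,1], so that L1 below is the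
   usual space L_1[0,1]. *)
Definition lebesgue01 : {measure set (measurableTypeR R) -> \bar R} :=
  mrestr lebesgue_measure (measurable_itv `[0 : R, 1]).

Definition L1 : normedModType R := LspaceType1 lebesgue01.

End L1_unit_interval.

Section operators.
Context {R : realType}.
Implicit Types V W : normedModType R.

Definition bounded_operator V W (A : {linear V -> W}) : Prop :=
  exists C : R, forall x, `|A x| <= C * `|x|.

Definition operator_norm V W (A : V -> W) : \bar R :=
  ereal_sup [set `|A x|%:E | x in [set x : V | `|x| <= 1]].

(* R^o is the scalar field R viewed as a normed space over itself. *)
Definition weakly_converges_to V (u : nat -> V) (l : V) : Prop :=
  forall phi : {linear V -> R^o}, bounded_operator phi ->
    phi (u n) @[n --> \oo] --> phi l.

Definition completely_continuous V W (A : {linear V -> W}) : Prop :=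
  forall (u : nat -> V) (l : V), weakly_converges_to u l ->
    cvgn (fun n => A (u n)).

Definition complete_continuity_property (X : completeNormedModType R) : Prop :=
  forall A : {linear L1 R -> X}, bounded_operator A -> completely_continuous A.

End operators.

Section closed_subspaces.
Context {R : realType} {X : completeNormedModType R}.

Record closedSubspace := ClosedSubspace {
  closedSubspace_set :> set X;
  closedSubspace_submod : submod_closed (mem closedSubspace_set : {pred X});
  closedSubspace_closed : closed closedSubspace_set
}.

Variable S : closedSubspace.

(* The Banach space whose elements are those of S, with the operations and the
   norm inherited from X. *)
Definition closedSubspace_pred : {pred X} := mem (S : set X).

HB.instance Definition _ := GRing.isSubmodClosed.Build R X closedSubspace_pred
  (closedSubspace_submod S).

Record subspaceType := SubspaceElt {
  subspace_val : X;
  subspace_valP : subspace_val \in closedSubspace_pred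
}.

HB.instance Definition _ := [isSub for subspace_val].
HB.instance Definition _ := [Choice of subspaceType by <:].
HB.instance Definition _ := [SubChoice_isSubLmodule of subspaceType by <:].

Definition subspace_norm (x : subspaceType) : R := `|subspace_val x|.

Lemma ler_subspace_normD x y :
  subspace_norm (x + y) <= subspace_norm x + subspace_norm y.
Proof. exact: ler_normD. Qed.

Lemma subspace_normZ (a : R) x : subspace_norm (a *: x) = `|a| * subspace_norm x.
Proof. exact: normrZ. Qed.

Lemma subspace_norm_eq0 x : subspace_norm x = 0 -> x = 0.
Proof. by move=> /normr0_eq0 x0; exact: val_inj. Qed.

HB.instance Definition _ := Lmodule_isNormed.Build R subspaceType
  ler_subspace_normD subspace_normZ subspace_norm_eq0.

Lemma subspace_complete (F : set_system subspaceType) :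
  ProperFilter F -> cauchy F -> cvg F.
Proof.
move=> FF /cauchy_ballP Fc.
have /cvg_ex[/= l Fl] : cvg (subspace_val @ F).
  apply: cauchy_cvg; apply/cauchy_ballP => e e0; rewrite near_map2.
  have := Fc e e0; apply: filterS => -[x y] /=.
  by rewrite -!ball_normE.
have Sl : closedSubspace_set S l.
  apply: (@closed_cvg _ _ F _ subspace_val (closedSubspace_set S) _ _ l Fl).
    exact: closedSubspace_closed.
  by apply: nearW => x; exact/set_mem/subspace_valP.
apply/cvg_ex; exists (SubspaceElt (mem_set Sl)).
apply/cvgrPdist_lt => e e0.
by move/cvgrPdist_lt : Fl => /(_ e e0).
Qed.

HB.instance Definition _ := Uniform_isComplete.Build subspaceType
  subspace_complete.

End closed_subspaces.
Arguments closedSubspace {R} X.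
Arguments subspaceType {R X} S.

Section finite_dimensional_decompositions.
Context {R : realType} {X : completeNormedModType R}.
Implicit Types (E : nat -> set X) (u : nat -> X).

(* A linear span of finitely many vectors; the zero subspace is the case n = 0. *)
Definition finite_dimensional_subspace (Y : set X) : Prop :=
  exists (n : nat) (e : 'I_n -> X),
    Y = [set \sum_(i < n) a i *: e i | a in [set: 'I_n -> R]].

Definition is_expansion E (x : X) u : Prop :=
  (forall j, E j (u j)) /\ series u @ \oo --> x.

Definition is_fdd E : Prop :=
  (forall j, finite_dimensional_subspace (E j)) /\
  (forall x, exists! u, is_expansion E x u).

(* For a finite dimensional decomposition E, the unique expansion of x (and a
   junk value if x has no expansion along E). *)
Definition fdd_expansion E (x : X) : nat -> X := get [set u | is_expansion E x u].

(* The summands are indexed from 0, so that this is the sum over j <= n. *)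
Definition fdd_projection E (n : nat) (x : X) : X :=
  \sum_(0 <= j < n.+1) fdd_expansion E x j.

Definition fdd_constant E : \bar R :=
  ereal_sup (range (fun n => operator_norm (fdd_projection E n))).

End finite_dimensional_decompositions.

(* Main.v *)
From HB Require Import structures.
Require Import Defs.
From mathcomp Require Import all_boot all_order all_algebra finmap.
From mathcomp Require Import all_classical all_reals all_analysis.
From mathcomp Require Import measurable_realfun.
From mathcomp Require Import lra ring.
Import Order.TTheory GRing.Theory Num.Theory.
Import numFieldNormedType.Exports.
Local Open Scope classical_set_scope.
Local Open Scope ring_scope.

Set Implicit Arguments.
Unset Strict Implicit.
Unset Printing Implicit Defensive.

(** A bounded operator [A] from [L1] to [X] that is not completely continuous is
    replaced by one whose image of the Haar system is almost a monotone
    sequence of finite dimensional blocks.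

    Let [f_0, f_1, ...] be measurable functions bounded by [1].  The Riesz
    products [w = prod_(k < n) (1 +- f_k)], indexed by the dyadic intervals of
    level [n] through their signs, are nonnegative and form a martingale: [w] is
    the mean of its successors [w * (1 + f_n)] and [w * (1 - f_n)].  If every
    [f_n] is orthogonal to the products of level [n], they have norm one in [L1],
    so their images under [A] form a bounded tree in [X].  Such a tree defines a
    bounded operator on [L1], sending the indicator of a dyadic interval of
    level [n] to [2 ^- n] times the vertex; it exists on all of [L1] because
    dyadic step functions are dense ([dyadic_density]).  It maps the [n]-th
    Rademacher function to [A f_n].

    Let the first block be spanned by the root, and the next ones by the
    differences [A (w * f_n)], [w] of level [n].  The sum of the first [n + 1]
    blocks is the span of the vertices of level [n]; it is finite dimensional,
    so finitely many functionals norm it up to the factor [1 + eps]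
    ([almost_orthogonal]).  If all later differences are killed by these
    functionals, the partial sum projections have norm at most [1 + eps], and
    the closed span of the tree has the blocks as a decomposition
    ([fdd_criterion]).  If moreover the norms of the [A f_n] are at least [d > 0],
    the images of the Rademacher functions lie in distinct blocks and stay away
    from each other, while these functions are weakly null by Bessel's
    inequality ([rademacher_weakly_null]): the new operator is not completely
    continuous.

    The conditions on [f_n] say that finitely many linear forms vanish on it, so
    everything rests on [large_on_kernels]: there is [d > 0] such that any
    finite list of bounded forms has in its common kernel a function bounded by
    [1] whose image under [A] has norm at least [d].  A weakly null sequence with
    large images provides it.  By a gliding hump argument it is uniformly
    integrable, so it is close to a sequence of functions with a common bound
    ([weakly_null_truncation]).  A difference of two of these functions on which
    the forms almost agree is corrected into the kernel by a small function
    ([small_correction]), and its image is large since the norm of [X] is weakly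
    lower semicontinuous. *)

(** * Norming functionals *)

Section hahn_banach.
Context {R : realType} {V : normedModType R}.
Implicit Types (G : set (V * R)) (x y v : V).

(** A graph [G] satisfying this is the graph of a functional of norm at most
    one on a subspace: the bound forces [(0, r)] in [G] to have [r = 0]. *)
Definition contractive_graph G : Prop :=
  [/\ G (0, 0),
      forall a x r y s, G (x, r) -> G (y, s) -> G (a *: x + y, a * r + s) &
      forall x r, G (x, r) -> r <= `|x|].

(** The value [c] at the new vector must lie above all [r - |x - v|] and below
    all [|y + v| - s] for [(x, r)] and [(y, s)] in the graph; the triangle
    inequality leaves room for it, and homogeneity reduces the bound on
    [x + t *: v] to these two cases. *)
Lemma contractive_graph_extend G v : contractive_graph G ->
  exists c, contractive_graph
    [set p | exists x r t, G (x, r) /\ p = (x + t *: v, r + t * c)].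
Proof.
move=> [G0 GL Gle].
pose A := [set q | exists x r, G (x, r) /\ q = r - `|x - v|].
have GA x r y s : G (x, r) -> G (y, s) -> r - `|x - v| <= `|y + v| - s.
  move=> Gx Gy; have /Gle := GL 1 _ _ _ _ Gx Gy.
  rewrite scale1r mul1r => h.
  have : `|x + y| <= `|x - v| + `|y + v|.
    by rewrite (le_trans _ (ler_normD _ _))// addrACA addNr addr0.
  lra.
have hsA : has_sup A.
  split; first by exists (0 - `|0 - v|), 0, 0.
  exists (`|0 + v| - 0) => _ [x [r [Gx ->]]]; exact: GA.
exists (sup A).
have c1 x r : G (x, r) -> r - `|x - v| <= sup A.
  by move=> Gx; apply: sup_upper_bound => //; exists x, r.
have c2 y s : G (y, s) -> sup A <= `|y + v| - s.
  move=> Gy; apply: ge_sup; first by case: hsA.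
  by move=> _ [x [r [Gx ->]]]; exact: GA.
have GZ a x r : G (x, r) -> G (a *: x, a * r).
  by move=> Gx; have := GL a _ _ _ _ Gx G0; rewrite !addr0.
split.
- by exists 0, 0, 0; rewrite scale0r mul0r !addr0.
- move=> a _ _ _ _ [x [r [t [Gx [-> ->]]]]] [y [s [u [Gy [-> ->]]]]].
  exists (a *: x + y), (a * r + s), (a * t + u); split; first exact: GL.
  congr pair; last by ring.
  by rewrite scalerDr scalerA scalerDl addrACA.
- move=> _ _ [x [r [t [Gx [-> ->]]]]].
  have [t0|t0|->] := ltgtP t 0; last by rewrite scale0r mul0r !addr0; exact: Gle.
  + have := c1 _ _ (GZ (- t)^-1 _ _ Gx).
    have -> : (- t)^-1 *: x - v = (- t)^-1 *: (x + t *: v).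
      by rewrite scalerDr scalerA invrN mulNr mulVf ?lt_eqF// scaleN1r.
    rewrite normrZ gtr0_norm ?invr_gt0 ?oppr_gt0//.
    rewrite -mulrBr ler_pdivrMl ?oppr_gt0//; lra.
  + have := c2 _ _ (GZ t^-1 _ _ Gx).
    have -> : t^-1 *: x + v = t^-1 *: (x + t *: v).
      by rewrite scalerDr scalerA mulVf ?gt_eqF// scale1r.
    rewrite normrZ gtr0_norm ?invr_gt0//.
    rewrite -mulrBr ler_pdivlMl//; lra.
Qed.

(** The Hahn-Banach theorem: a maximal contractive graph containing
    [(t *: v, t * |v|)] is total, since otherwise it could be extended by one
    more dimension. *)
Lemma norming_functional v : exists phi : {linear V -> R^o},
  (forall x, `|phi x| <= `|x|) /\ phi v = `|v|.
Proof.
pose G0 := [set p : V * R | exists t, p = (t *: v, t * `|v|)].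
have cG0 : contractive_graph G0.
  split; first by exists 0; rewrite scale0r mul0r.
  - move=> a _ _ _ _ [t [-> ->]] [u [-> ->]]; exists (a * t + u).
    by rewrite scalerA scalerDl mulrA mulrDl.
  - by move=> _ _ [t [-> ->]]; rewrite normrZ ler_wpM2r// ler_norm.
(* The empty graph satisfies [P] so that the empty chain has an upper bound. *)
pose P (G : set (V * R)) := G = set0 \/ contractive_graph G /\ G0 `<=` G.
have [F FP Ftot|G [PG Gmax]] := @Zorn_bigcup _ P.
  have [[G1 FG1 G1n]|allF0] := pselect (exists2 G1, F G1 & G1 !=set0); last first.
    left; rewrite -subset0 => p [G1 FG1 G1p]; apply: allF0.
    by exists G1 => //; exists p.
  have ne G2 p : F G2 -> G2 p -> contractive_graph G2 /\ G0 `<=` G2.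
    by move=> /FP[->|].
  have [p G1p] := G1n; have [[G10 _ _] G01] := ne _ _ FG1 G1p.
  right; split; last by apply: (subset_trans G01); exact: bigcup_sup.
  split; first by exists G1.
  + move=> a x r y s [G2 FG2 G2x] [G3 FG3 G3y].
    have [G23|G32] := Ftot _ _ FG2 FG3.
    * have [[_ L _] _] := ne _ _ FG3 G3y.
      by exists G3 => //; apply: L => //; exact: G23.
    * have [[_ L _] _] := ne _ _ FG2 G2x.
      by exists G2 => //; apply: L => //; exact: G32.
  + by move=> x r [G2 FG2 G2x]; have [[_ _ +] _] := ne _ _ FG2 G2x; apply.
have G00 : G0 (0, 0) by exists 0; rewrite scale0r mul0r.
have {PG}[Ge|[cG G0G]] := PG.
  exfalso; apply: (Gmax G0); last by right; split.
  by rewrite Ge; split => // /(_ _ G00).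
have total x : exists r, G (x, r).
  apply: contrapT => nx; have [c cG'] := contractive_graph_extend x cG.
  set G' := [set _ | _] in cG'.
  have GG' : G `<=` G'.
    by move=> [y r] Gy; exists y, r, 0; rewrite scale0r mul0r !addr0.
  apply: (Gmax G'); last by right; split => //; exact: subset_trans GG'.
  split => // /(_ (x, c)) G'x; apply: nx; exists c; apply: G'x.
  by exists 0, 0, 1; rewrite scale1r mul1r !add0r; case: cG.
have [f fG] := choice total.
have [_ GL Gle] := cG.
have uniq x r s : G (x, r) -> G (x, s) -> r = s.
  have le r' s' : G (x, r') -> G (x, s') -> s' <= r'.
    move=> Gr Gs; have /Gle := GL (-1) _ _ _ _ Gr Gs.
    by rewrite scaleN1r addNr normr0 mulN1r addrC subr_le0.
  by move=> Gr Gs; apply/eqP; rewrite eq_le !le.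
have flin : linear (f : V -> R^o).
  by move=> a x y; apply: uniq (fG _) _; exact: GL.
pose phi : {linear V -> R^o} := HB.pack f (GRing.isLinear.Build _ _ _ _ _ flin).
exists phi; split.
  move=> x; rewrite ler_norml (Gle _ _ (fG x)) andbT lerNl.
  have := Gle _ _ (fG (- x)); rewrite normrN.
  by have := raddfN phi x => /= ->.
apply: uniq (fG v) _; apply: G0G; exists 1; by rewrite scale1r mul1r.
Qed.

End hahn_banach.

(** * Ultrafilter limits and spans of finitely many vectors *)

Section free_ultrafilter.
Context {R : realType}.

Lemma free_ultrafilter : exists U : set_system nat, UltraFilter U /\ \oo `<=` U.
Proof. exact: ultraFilterLemma. Qed.

(** Limits along one fixed free ultrafilter exist for all bounded sequences at
    once, without any extraction of subsequences. *)
Lemma bounded_ultra_cvg (U : set_system nat) (a : nat -> R) (C : R) :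
  UltraFilter U -> (forall n, `|a n| <= C) -> exists l : R, a @ U --> l.
Proof.
move=> UU aC.
have [l [_ cl]] : `[- C, C]%classic `&` cluster (a @ U) !=set0.
  apply: segment_compact; apply: (@filterS _ U _ setT) filterT => n _ /=.
  by rewrite in_itv /= -ler_norml; exact: aC.
exists l => A lA.
have [//|UnA] := in_ultra_setVsetC (a @^-1` A) UU.
by have [y [/= nAy Ay]] := cl (~` A) A UnA lA.
Qed.

Lemma ultra_ex (U : set_system nat) (A : set nat) : UltraFilter U -> U A ->
  exists n, A n.
Proof. by move=> UU; exact: filter_ex. Qed.

End free_ultrafilter.

Section linear_spans.
Context {R : realType} {V : normedModType R}.
Implicit Types (e : nat -> V) (n : nat).

Definition lspan n e : set V :=
  [set x | exists a : nat -> R, x = \sum_(i < n) a i *: e i].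

Lemma lspan0 n e : lspan n e 0.
Proof. by exists (fun=> 0); rewrite big1// => i _; rewrite scale0r. Qed.

Lemma lspanP n e a x y : lspan n e x -> lspan n e y -> lspan n e (a *: x + y).
Proof.
move=> [b ->] [c ->]; exists (fun i => a * b i + c i).
rewrite scaler_sumr -big_split; apply: eq_bigr => i _ /=.
by rewrite scalerDl scalerA.
Qed.

Lemma lspanZ n e a x : lspan n e x -> lspan n e (a *: x).
Proof. by move=> h; rewrite -[_ *: _]addr0; apply: lspanP => //; exact: lspan0. Qed.

Lemma lspanD n e x y : lspan n e x -> lspan n e y -> lspan n e (x + y).
Proof. by move=> hx hy; rewrite -[x]scale1r; exact: lspanP. Qed.

Lemma lspanB n e x y : lspan n e x -> lspan n e y -> lspan n e (x - y).
Proof. by move=> hx hy; rewrite addrC -scaleN1r; exact: lspanP. Qed.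

Lemma lspan_sum n e (I : Type) (r : seq I) (P : pred I) (F : I -> V) :
  (forall i, P i -> lspan n e (F i)) -> lspan n e (\sum_(i <- r | P i) F i).
Proof.
by move=> h; elim/big_ind : _ => //; [exact: lspan0|move=> *; exact: lspanD].
Qed.

Lemma lspan_gen n e i : (i < n)%N -> lspan n e (e i).
Proof.
move=> ltin; exists (fun j => (j == i)%:R).
rewrite (bigD1 (Ordinal ltin))//= eqxx scale1r big1 ?addr0// => j.
by rewrite -val_eqE /= => /negbTE ->; rewrite scale0r.
Qed.

Lemma lspan_sub n e m d : (forall i, (i < n)%N -> lspan m d (e i)) ->
  lspan n e `<=` lspan m d.
Proof.
by move=> h _ [a ->]; apply: lspan_sum => i _; apply: lspanZ; exact: h.
Qed.

Lemma lspanS n e x :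
  lspan n.+1 e x <-> exists y t, lspan n e y /\ x = y + t *: e n.
Proof.
split=> [[a ->]|[y [t [Yy ->]]]].
  exists (\sum_(i < n) a i *: e i), (a n); split; first by exists a.
  by rewrite big_ord_recr.
apply: lspanD; last by apply: lspanZ; exact: lspan_gen.
by apply: lspan_sub Yy => i ltin; apply: lspan_gen; exact: ltnW.
Qed.

Lemma closedP_norm (S : set V) :
  closed S <-> forall x, (forall r, 0 < r -> exists2 y, S y & `|x - y| < r) -> S x.
Proof.
split=> [cS x h|h x clx].
  apply: cS => A /nbhs_ballP[r /= r0 rA]; have [y Sy xy] := h r r0.
  by exists y; split => //; apply: rA; rewrite -ball_normE.
apply: h => r r0; have [y [Sy]] := clx _ (nbhsx_ballx x r r0).
by rewrite -ball_normE => xy; exists y.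
Qed.

(** Both statements are proved together: a vector outside of a closed span is
    at a positive distance from it, which bounds its coefficient, and bounded
    coefficients make the next span closed. *)
Lemma lspan_coef_closed n e :
  (exists2 C, 0 <= C & forall x, lspan n e x -> exists a : nat -> R,
     x = \sum_(i < n) a i *: e i /\ forall i, (i < n)%N -> `|a i| <= C * `|x|) /\
  closed (lspan n e).
Proof.
elim: n => [|n [[C C0 IHC] IHcl]].
  split; first exists 0 => // x [a ->].
    by exists a; split=> // -[].
  have -> : lspan 0 e = [set 0].
    by apply/seteqP; split=> x => [[a ->]|->]; [rewrite big_ord0|exact: lspan0].
  apply/closedP_norm => x hx; apply: contrapT => /eqP x0.
  have [|y ->] := hx `|x|; first by rewrite normr_gt0.
  by rewrite subr0 ltxx.
have [een|nen] := pselect (lspan n e (e n)).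
  have ee : lspan n.+1 e = lspan n e.
    apply/seteqP; split; apply: lspan_sub => i.
      by rewrite ltnS leq_eqVlt => /predU1P[->//|]; exact: lspan_gen.
    by move=> ltin; apply: lspan_gen; exact: ltnW.
  rewrite ee; split => //; exists C => // x /IHC[a [xE aC]].
  exists (fun i => if i == n then 0 else a i); split.
    rewrite big_ord_recr/= eqxx scale0r addr0 xE; apply: eq_bigr => i _.
    by rewrite ltn_eqF.
  move=> i; rewrite ltnS => iln; case: eqP => [_|/eqP ni]; first by rewrite normr0 mulr_ge0.
  have ltin : (i < n)%N by rewrite ltn_neqAle ni.
  exact: aC.
have [d d0 dP] : exists2 d, 0 < d & forall y, lspan n e y -> d <= `|e n - y|.
  apply: contrapT => h; apply: nen; move/closedP_norm : IHcl; apply => r r0.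
  apply: contrapT => h2; apply: h; exists r => // y Yy.
  by rewrite leNgt; apply/negP => yr; apply: h2; exists y.
have dP' y t : lspan n e y -> d * `|t| <= `|y + t *: e n|.
  move=> Yy; have [->|t0] := eqVneq t 0; first by rewrite normr0 mulr0.
  have -> : y + t *: e n = t *: (e n - (- t^-1) *: y).
    by rewrite scalerBr scalerA mulrN divff// scaleN1r opprK addrC.
  rewrite normrZ mulrC ler_wpM2l//; apply: dP; exact: lspanZ.
split.
  exists (C * (1 + `|e n| / d) + d^-1).
    by rewrite addr_ge0 ?mulr_ge0 ?addr_ge0 ?divr_ge0 ?invr_ge0// ltW.
  move=> x /lspanS[y [t [Yy xE]]].
  have tx : `|t| <= d^-1 * `|x| by rewrite ler_pdivlMl// xE; exact: dP'.
  have yx : `|y| <= (1 + `|e n| / d) * `|x|.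
    have -> : y = x - t *: e n by rewrite xE addrK.
    rewrite (le_trans (ler_normB _ _))// normrZ mulrDl mul1r lerD2l.
    by rewrite mulrC -mulrA ler_wpM2l.
  have [a [yE aC]] := IHC _ Yy.
  exists (fun i => if i == n then t else a i); split.
    rewrite big_ord_recr/= eqxx xE yE; congr (_ + _); apply: eq_bigr => i _.
    by rewrite ltn_eqF.
  move=> i; rewrite ltnS mulrDl => iln; case: eqP => [_|/eqP ni].
    by rewrite (le_trans tx)// lerDr !mulr_ge0// addr_ge0// divr_ge0// ltW.
  have ltin : (i < n)%N by rewrite ltn_neqAle ni.
  rewrite (le_trans (aC _ ltin))// -mulrA.
  rewrite (le_trans (ler_wpM2l C0 yx))// lerDl mulr_ge0// invr_ge0 ltW//.
apply/closedP_norm => x hx.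
have /choice[z zP] : forall m : nat, exists z, exists y t,
    [/\ lspan n e y, z = y + t *: e n & `|x - z| < m.+1%:R^-1].
  move=> m; have [|z /lspanS[y [t [Yy ->]]] xz] := hx m.+1%:R^-1.
    by rewrite invr_gt0.
  by exists (y + t *: e n), y, t.
have /choice[y /choice[t ytP]] : forall m, exists y t,
    [/\ lspan n e y, z m = y + t *: e n & `|x - z m| < m.+1%:R^-1].
  by move=> m; exact: zP.
have tb m : `|t m| <= (`|x| + 1) / d.
  have [Yy zE xz] := ytP m.
  rewrite ler_pdivlMr// mulrC (le_trans (dP' _ _ Yy))// -zE.
  have -> : z m = x - (x - z m) by rewrite opprB addrC subrK.
  rewrite (le_trans (ler_normB _ _))// lerD2l (le_trans (ltW xz))//.
  by rewrite invf_le1 ?ler1n.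
have [U [UU ooU]] := free_ultrafilter.
have [l tl] := bounded_ultra_cvg UU tb.
apply/lspanS; exists (x - l *: e n), l; split; last by rewrite subrK.
move/closedP_norm : IHcl; apply => r r0.
have K0 : 0 < 1 + `|e n| by rewrite ltr_pwDl.
have r'0 : 0 < r / (1 + `|e n|) by rewrite divr_gt0.
have [m [mr tml]] : exists m, m.+1%:R^-1 < r / (1 + `|e n|) /\
    `|l - t m| < r / (1 + `|e n|).
  apply: (@ultra_ex U) => //; apply: filterI.
    by apply: ooU; exact: near_infty_natSinv_lt (PosNum r'0).
  by move/cvgrPdist_lt : tl; exact.
have [Yy zE xz] := ytP m.
exists (y m) => //.
have -> : x - l *: e n - y m = (x - z m) - (l - t m) *: e n.
  by rewrite zE scalerBl opprB opprD !addrA addrNK addrAC.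
rewrite (le_lt_trans (ler_normB _ _))// normrZ.
have -> : r = r / (1 + `|e n|) + r / (1 + `|e n|) * `|e n|.
  by field; rewrite gt_eqF.
rewrite ltr_leD//; first exact: lt_trans xz mr.
by rewrite ler_wpM2r// ltW.
Qed.

End linear_spans.

(** * Almost orthogonality *)

Section finite_norming_sets.
Context {R : realType} {V : normedModType R}.
Implicit Types (e : nat -> V) (n : nat).

Lemma interval_net (C d : R) : 0 <= C -> 0 < d ->
  exists s : seq R, forall t, `|t| <= C -> exists2 u, u \in s & `|t - u| <= d.
Proof.
move=> C0 d0.
exists [seq k%:R * d - C | k <- iota 0 (Num.truncn ((C + C) / d)).+1] => t.
rewrite ler_norml => /andP[Ct tC].
have u0 : 0 <= (t + C) / d by rewrite divr_ge0 ?(ltW d0)//; lra.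
have /andP[k1 k2] := truncn_itv u0.
exists ((Num.truncn ((t + C) / d))%:R * d - C).
  apply/mapP; exists (Num.truncn ((t + C) / d)) => //.
  by rewrite mem_iota add0n leq0n ltnS le_truncn// ler_pM2r ?invr_gt0// lerD2r.
set k := Num.truncn _ in k1 k2 *.
move: k1 k2; rewrite ler_pdivlMr// ltr_pdivrMr// mulrSr mulrDl mul1r => k1 k2.
rewrite ler_norml; apply/andP; split; lra.
Qed.

Lemma box_net n e (C r : R) : 0 <= C -> 0 < r ->
  exists s : seq V, forall a : nat -> R, (forall i, (i < n)%N -> `|a i| <= C) ->
    exists2 p, p \in s & `|\sum_(i < n) a i *: e i - p| <= r.
Proof.
move=> C0; elim: n r => [|n IH] r r0.
  exists [:: 0] => a _; exists 0; first by rewrite inE.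
  by rewrite big_ord0 subr0 normr0 ltW.
have r20 : 0 < r / 2 by rewrite divr_gt0.
have [s sP] := IH _ r20.
have K0 : 0 < 1 + `|e n| by rewrite ltr_pwDl.
have [s' s'P] := interval_net C0 (divr_gt0 r20 K0).
exists [seq p + t *: e n | p <- s, t <- s'] => a aC.
have [p ps pr] := sP a (fun i ltin => aC i (ltnW ltin)).
have [t ts tr] := s'P _ (aC n (leqnn _)).
exists (p + t *: e n); first by apply/allpairsP; exists (p, t).
rewrite big_ord_recr/= opprD addrACA -scalerBl.
rewrite (le_trans (ler_normD _ _))// normrZ.
have -> : r = r / 2 + (r / 2 / (1 + `|e n|)) * (1 + `|e n|).
  by field; rewrite gt_eqF.
by rewrite lerD// ler_pM// lerDr.
Qed.

Definition contractive_functional (phi : V -> R) : Prop :=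
  linear (phi : V -> R^o) /\ forall x, `|phi x| <= `|x|.

(** The conclusion is the almost orthogonality that gives the constant of the
    decomposition: if finitely many functionals nearly norm a finite
    dimensional space, adding a vector of their common kernel can hardly
    decrease the norm.  They are taken to norm a fine net of the unit ball. *)
Lemma almost_orthogonal n e (eps : R) : 0 < eps ->
  exists s : seq (V -> R), (forall phi, phi \in s -> contractive_functional phi) /\
    forall y z, lspan n e y -> (forall phi, phi \in s -> phi z = 0) ->
      `|y| <= (1 + eps) * `|y + z|.
Proof.
move=> eps0; have [[C C0 coef] _] := lspan_coef_closed n e.
have eps1 : 0 < 1 + eps by rewrite addr_gt0.
(* [1 - 2 * r] is the inverse of [1 + eps]. *)
pose r := eps / (2 * (1 + eps)).
have r0 : 0 < r by rewrite divr_gt0 ?mulr_gt0.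
have [s sP] := box_net n e C0 r0.
have /choice[psi psiP] : forall p : V, exists phi : V -> R,
    contractive_functional phi /\ phi p = `|p|.
  move=> p; have [phi [h1 h2]] := norming_functional p; exists phi; split => //.
  by split => // a x y; rewrite linearP.
exists (map psi s); split; first by move=> phi /mapP[p _ ->]; case: (psiP p).
move=> y z Yy sz.
have [->|y0] := eqVneq y 0; first by rewrite normr0 mulr_ge0// ltW.
have ny0 : 0 < `|y| by rewrite normr_gt0.
have [a [yE aC]] := coef (`|y|^-1 *: y) (lspanZ _ Yy).
have y1 : `| `|y|^-1 *: y | = 1.
  by rewrite normrZ ger0_norm ?invr_ge0// mulVf ?gt_eqF.
rewrite y1 mulr1 in aC.
have [p ps] := sP a aC; rewrite -yE => pr.
have [[plin ple] pE] := psiP p.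
have ppsi : psi p \in map psi s by apply/mapP; exists p.
have pD x x' : psi p (x + x') = psi p x + psi p x'.
  by have := plin 1 x x'; rewrite !scale1r.
have p0 : psi p 0 = 0 by have := pD 0 0; rewrite addr0; lra.
have pZ b x : psi p (b *: x) = b * psi p x.
  by have := plin b x 0; rewrite !addr0 p0 addr0.
have h1 : 1 <= psi p (`|y|^-1 *: y) + 2 * r.
  have : `|p| - r <= psi p (`|y|^-1 *: y).
    have -> : `|y|^-1 *: y = p + (`|y|^-1 *: y - p) by rewrite addrC subrK.
    rewrite pD pE; have := le_trans (ple (`|y|^-1 *: y - p)) pr.
    by rewrite ler_norml => /andP[]; lra.
  have : 1 <= `|p| + r.
    rewrite -y1 -[X in `|X| <= _](subrK p) addrC.
    by rewrite (le_trans (ler_normD _ _))// lerD2l.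
  lra.
have h2 : psi p (`|y|^-1 *: y) <= `|y|^-1 * `|y + z|.
  rewrite pZ ler_wpM2l ?invr_ge0//.
  have -> : psi p y = psi p (y + z) by rewrite pD (sz _ ppsi) addr0.
  by rewrite (le_trans (ler_norm _))// ple.
have : 1 - 2 * r <= `|y|^-1 * `|y + z| by lra.
have -> : 1 - 2 * r = (1 + eps)^-1 by rewrite /r; field; rewrite gt_eqF.
by rewrite ler_pdivlMl// ler_pdivrMr// mulrC.
Qed.

End finite_norming_sets.

(** * A criterion for finite dimensional decompositions *)

Section norm_sequences.
Context {R : realType} {V : normedModType R}.
Implicit Types u : nat -> V.

Lemma cvg_seqP u l : u @ \oo --> l <->
  forall r, 0 < r -> exists N, forall n, (N <= n)%N -> `|u n - l| < r.
Proof.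
split=> [/cvgrPdist_lt ul r r0|h].
  by have [N _ hN] := ul r r0; exists N => n /hN; rewrite distrC.
apply/cvgrPdist_lt => r r0; have [N hN] := h r r0.
by exists N => // n /= /hN; rewrite distrC.
Qed.

Lemma cauchy_ex_lim (W : completeNormedModType R) (u : nat -> W) :
  (forall r, 0 < r -> exists N, forall n k, (N <= n)%N -> (N <= k)%N ->
     `|u n - u k| < r) -> exists l : W, u @ \oo --> l.
Proof.
move=> h; suff /cvg_ex : cvg (u @ \oo) by [].
apply: cauchy_cvg; apply/cauchy_ballP => r r0; have [N hN] := h r r0.
rewrite near_map2; exists ([set n | (N <= n)%N], [set n | (N <= n)%N]).
  by split; exists N.
by move=> [n k] /= [Nn Nk]; rewrite -ball_normE /=; exact: hN.
Qed.

Lemma closed_seq_lim (S : set V) u l :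
  closed S -> (forall n, S (u n)) -> u @ \oo --> l -> S l.
Proof.
move=> /closedP_norm cS Su /cvg_seqP ul; apply: cS => r r0.
by have [N hN] := ul r r0; exists (u N) => //; rewrite distrC hN.
Qed.

Lemma norm_lim_le u l y (B : R) : u @ \oo --> l ->
  (exists N, forall n, (N <= n)%N -> `|y - u n| <= B) -> `|y - l| <= B.
Proof.
move=> /cvg_seqP ul [N hN]; apply/ler_addgt0Pl => r r0.
have [M hM] := ul r r0.
have -> : y - l = (y - u (maxn N M)) + (u (maxn N M) - l).
  by rewrite addrA subrK.
rewrite addrC (le_trans (ler_normD _ _))// lerD ?hN ?leq_maxl//.
by rewrite ltW// hM// leq_maxr.
Qed.

End norm_sequences.

Section fdd_criterion.
Context {R : realType} {Y : completeNormedModType R}.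
Variables (m : nat -> nat) (g : nat -> nat -> Y) (C : R).

Let E (j : nat) : set Y := lspan (m j) (g j).

Hypothesis C0 : 0 <= C.
Hypothesis partial_sum_bound : forall (u : nat -> Y) n k,
  (forall j, E j (u j)) -> (n <= k)%N ->
  `|\sum_(0 <= j < n) u j| <= C * `|\sum_(0 <= j < k) u j|.
Hypothesis dense_span : forall x r, 0 < r -> exists (u : nat -> Y) n,
  (forall j, E j (u j)) /\ `|x - \sum_(0 <= j < n) u j| < r.

Lemma lspan_finite_dimensional n (e : nat -> Y) :
  finite_dimensional_subspace (lspan n e).
Proof.
exists n, (fun i => e i); apply/seteqP; split=> x.
  by move=> [a ->]; exists (fun i => a i).
move=> [a _ <-].
exists (fun k => if insub k is Some i then a i else 0).
by apply: eq_bigr => i _; rewrite valK.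
Qed.

Lemma expansion_bound x u n : is_expansion E x u ->
  `|\sum_(0 <= j < n) u j| <= C * `|x|.
Proof.
move=> [Eu /cvg_seqP ux]; apply/ler_addgt0Pl => r r0.
have K0 : 0 < 1 + C by rewrite ltr_pwDl.
have [N hN] := ux _ (divr_gt0 r0 K0).
have /ltW := hN (maxn N n) (leq_maxl _ _).
rewrite seriesEnat /= => h.
apply: (le_trans (partial_sum_bound Eu (leq_maxr N n))).
set s := \sum_(0 <= j < maxn N n) u j in h *.
have : `|s| <= `|x| + r / (1 + C).
  by rewrite -[X in `|X| <= _](subrK x) addrC (le_trans (ler_normD _ _))// lerD2l.
move=> /(ler_wpM2l C0)/le_trans; apply.
by rewrite mulrDr (addrC r) lerD2l mulrA ler_pdivrMr// mulrDr mulr1 (mulrC r) lerDr ltW.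
Qed.

Lemma expansion_unique x u v :
  is_expansion E x u -> is_expansion E x v -> u = v.
Proof.
move=> [Eu ux] [Ev vx].
have uv : is_expansion E 0 (u \- v).
  split=> [j|]; first exact: (lspanB (Eu j) (Ev j)).
  rewrite -(subrr x); have -> : series (u \- v) = series u \- series v.
    by apply/funext => n; rewrite !seriesEnat /= sumrB.
  exact: cvgB.
have s0 n : \sum_(0 <= j < n) (u \- v) j = 0.
  apply/eqP; rewrite -normr_le0.
  by have := expansion_bound n uv; rewrite normr0 mulr0.
apply/funext => n; apply/eqP; rewrite -subr_eq0; apply/eqP.
by have := s0 n.+1; rewrite big_nat_recr//= s0 add0r.
Qed.

Lemma expansion_exists x : exists u, is_expansion E x u.
Proof.
have /choice[v0 /choice[k v0P]] : forall i : nat, exists (v : nat -> Y) n,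
    (forall j, E j (v j)) /\ `|x - \sum_(0 <= j < n) v j| < i.+1%:R^-1.
  by move=> i; apply: dense_span; rewrite invr_gt0.
(* [X i] approximates [x] by the finite sum of the [v i j], and [S i n] is its
   [n]-th partial sum: it converges in [i] because the partial sum maps are
   uniformly bounded. *)
pose v i j := if (j < k i)%N then v0 i j else 0.
have Ev i j : E j (v i j).
  by rewrite /v; case: ifP => _; [have [+ _] := v0P i; exact|exact: lspan0].
pose S i n := \sum_(0 <= j < n) v i j.
pose X i := S i (k i).
have SX i n : (k i <= n)%N -> S i n = X i.
  move=> kn; rewrite /S (big_cat_nat (leq0n _) kn)/= [X in _ + X]big_nat_cond.
  rewrite [X in _ + X]big1 ?addr0// => j /andP[/andP[kj _] _].
  by rewrite /v ltnNge kj.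
have XE i : X i = \sum_(0 <= j < k i) v0 i j.
  rewrite /X /S !big_nat; apply: eq_bigr => j /andP[_ jk].
  by rewrite /v jk.
have xX i : `|x - X i| < i.+1%:R^-1 by rewrite XE; case: (v0P i).
have SB i i' n : `|S i n - S i' n| <= C * `|X i - X i'|.
  pose w := v i \- v i'.
  have Sw l : \sum_(0 <= j < l) w j = S i l - S i' l by rewrite sumrB.
  have Ew j : E j (w j) by exact: (lspanB (Ev i j) (Ev i' j)).
  have := partial_sum_bound Ew (leq_maxl n (maxn (k i) (k i'))).
  by rewrite !Sw !(SX _ (maxn _ _)) ?leq_max ?leqnn ?orbT.
have xcvg : X @ \oo --> x.
  apply/cvg_seqP => r r0; have [N _ hN] := near_infty_natSinv_lt (PosNum r0).
  by exists N => n Nn; rewrite distrC (lt_trans (xX n))//; exact: hN.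
have XC r : 0 < r -> exists N, forall n n', (N <= n)%N -> (N <= n')%N ->
    `|X n - X n'| < r.
  move=> r0; have r20 : 0 < r / 2 by rewrite divr_gt0.
  have /cvg_seqP/(_ _ r20)[N hN] := xcvg.
  exists N => n n' /hN h /hN h'.
  have -> : X n - X n' = (X n - x) - (X n' - x) by rewrite opprB addrA subrK.
  by rewrite (le_lt_trans (ler_normB _ _))// (splitr r) ltrD.
have K0 : 0 < 1 + C by rewrite ltr_pwDl.
have /choice[L SL] : forall n, exists l : Y, (S ^~ n) @ \oo --> l.
  move=> n; apply: cauchy_ex_lim => r r0.
  have [N hN] := XC _ (divr_gt0 r0 K0); exists N => i i' Ni Ni'.
  rewrite (le_lt_trans (SB _ _ _))//.
  have := hN _ _ Ni Ni'; rewrite ltr_pdivlMr// mulrDr mulr1 mulrC.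
  by apply: le_lt_trans; rewrite lerDr.
pose u j := L j.+1 - L j.
have L0 : L 0%N = 0.
  apply: (@norm_cvg_unique _ _ _ _ _ _ (SL 0%N)).
  by rewrite (_ : S ^~ 0%N = cst 0); [exact: cvg_cst|
    apply/funext => i; rewrite /S big_geq].
have su n : \sum_(0 <= j < n) u j = L n by rewrite telescope_sumr// L0 subr0.
exists u; split=> [j|].
  have [_ cl] := lspan_coef_closed (m j) (g j).
  apply: (closed_seq_lim cl (Ev ^~ j)).
  rewrite (_ : v ^~ j = (S ^~ j.+1) \- (S ^~ j)); first exact: cvgB.
  by apply/funext => i; rewrite /= /S big_nat_recr//= addrAC subrr add0r.
apply/cvg_seqP => r r0.
have r30 : 0 < r / 2 / (1 + C) by rewrite !divr_gt0.
have [N hN] := XC _ r30.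
have /cvg_seqP/(_ _ (divr_gt0 r0 (ltr0n _ 2)))[N' hN'] := xcvg.
pose i := maxn N N'.
exists (k i) => n kn; rewrite seriesEnat /= su.
have h1 : `|X i - L n| <= r / 2 / (1 + C) * C.
  apply: (norm_lim_le (SL n)); exists N => i' Ni'.
  rewrite -(SX i n kn) (le_trans (SB _ _ _))// mulrC ler_wpM2r// ltW//.
  by apply: hN => //; exact: leq_maxl.
have h2 : r / 2 / (1 + C) * C <= r / 2.
  by rewrite mulrAC ler_pdivrMr// ler_wpM2l ?ltW ?divr_gt0// ltrDr.
have -> : L n - x = (X i - x) - (X i - L n).
  by rewrite opprB [RHS]addrC addrA subrK.
rewrite (le_lt_trans (ler_normB _ _))// (splitr r) ltr_leD//.
  by apply: hN'; exact: leq_maxr.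
exact: le_trans h1 h2.
Qed.

(** A dense sequence of finite dimensional subspaces whose partial sum maps are
    uniformly bounded on finite sums is a decomposition: the bound makes the
    partial sums of approximants converge, and the limits stay in the summands
    because finite dimensional subspaces are closed. *)
Lemma fdd_criterion : is_fdd E /\ (fdd_constant E <= C%:E)%E.
Proof.
have ex1 x : is_expansion E x (fdd_expansion E x).
  have [u xu] := expansion_exists x; exact: (@getI _ [set u | is_expansion E x u] u).
split; first split=> [j|x].
- exact: lspan_finite_dimensional.
- exists (fdd_expansion E x); split => // v; exact: expansion_unique.
apply: ub_ereal_sup => _ [n _ <-]; apply: ub_ereal_sup => _ [x /= x1 <-].
rewrite lee_fin (le_trans (expansion_bound _ (ex1 x)))//.
by rewrite ler_piMr.
Qed.

End fdd_criterion.

(** * Integration on the unit interval *)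

Section integration_on_unit_interval.
Context {R : realType}.

Local Notation T := (measurableTypeR R).
Local Notation mu := (lebesgue01 R).
Implicit Types (f g : T -> R) (F G : L1 R).

Definition intble f : Prop := mu.-integrable setT (EFin \o f).

Definition integ f : R := \int[mu]_x f x.

Definition bmeas (B : R) f : Prop :=
  measurable_fun setT f /\ forall x, `|f x| <= B.

Lemma lebesgue01T : mu setT = 1%E.
Proof.
rewrite /lebesgue01 /= /mrestr setTI lebesgue_measure_itv/= lte01.
by rewrite oppr0 adde0.
Qed.

Lemma intble_meas f : intble f -> measurable_fun setT f.
Proof. by move=> /integrableP[/measurable_EFinP]. Qed.

Lemma bmeas_intble B f : bmeas B f -> intble f.
Proof.
move=> [mf fB]; apply: measurable_bounded_integrable => //.
  by rewrite lebesgue01T ltry.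
by exists B; split; [exact: num_real|move=> M BM x _; exact: le_trans (fB x) (ltW BM)].
Qed.

Lemma bmeas_le B B' f : B <= B' -> bmeas B f -> bmeas B' f.
Proof. by move=> BB' [mf fB]; split=> // x; exact: le_trans (fB x) BB'. Qed.

Lemma bmeasP a B f B' g : bmeas B f -> bmeas B' g ->
  bmeas (`|a| * B + B') (a *: f + g).
Proof.
move=> [mf fB] [mg gB]; split.
  by apply: measurable_funD => //; apply: measurable_funM.
move=> x; rewrite (le_trans (ler_normD _ _))// lerD//.
by rewrite [X in `|X|](_ : _ = a * f x)// normrM ler_wpM2l.
Qed.

Lemma bmeasM B f B' g : bmeas B f -> bmeas B' g -> bmeas (B * B') (f * g).
Proof.
move=> [mf fB] [mg gB]; split; first exact: measurable_funM.
by move=> x; rewrite [X in `|X|](_ : _ = f x * g x)// normrM ler_pM.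
Qed.

Lemma bmeas_cst c : bmeas `|c| (cst c).
Proof. by split=> //; exact: measurable_cst. Qed.

Lemma bmeas_indic (A : set T) : measurable A -> bmeas 1 \1_A.
Proof.
move=> mA; split=> [|x]; first exact: measurable_indic.
by rewrite indicE; case: (x \in A); rewrite ?normr1 ?normr0.
Qed.

Lemma intbleP a f g : intble f -> intble g -> intble (a *: f + g).
Proof.
move=> If Ig; have := integrableD measurableT (integrableZl measurableT a If) Ig.
by apply: eq_integrable.
Qed.

Lemma intbleZ a f : intble f -> intble (a *: f).
Proof.
move=> If; rewrite -[a *: f]addr0; apply: intbleP => //.
exact: bmeas_intble (bmeas_cst 0).
Qed.

Lemma intbleD f g : intble f -> intble g -> intble (f + g).
Proof. by move=> If Ig; rewrite -[f]scale1r; exact: intbleP. Qed.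

Lemma intbleB f g : intble f -> intble g -> intble (f - g).
Proof. by move=> If Ig; rewrite addrC -scaleN1r; exact: intbleP. Qed.

Lemma intbleM B f g : bmeas B f -> intble g -> intble (f * g).
Proof.
move=> [mf fB] Ig.
have B0 : 0 <= B by exact: le_trans (normr_ge0 _) (fB 0).
apply: (le_integrable measurableT _ _ (integrableZl measurableT B Ig)).
  by apply/measurable_EFinP; apply: measurable_funM => //; exact: intble_meas.
move=> x _; rewrite lee_fin /= [X in `|X|](_ : _ = f x * g x)//.
by rewrite !normrM (ger0_norm B0) ler_wpM2r.
Qed.

Lemma intble_abs f : intble f -> intble (fun x => `|f x|).
Proof. by move=> If; have := integrable_abse If; apply: eq_integrable. Qed.

Lemma integP a f g : intble f -> intble g ->
  integ (a *: f + g) = a * integ f + integ g.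
Proof.
move=> If Ig; rewrite /integ -RintegralZl// -RintegralD//.
by have := integrableZl measurableT a If; apply: eq_integrable.
Qed.

Lemma integZ a f : intble f -> integ (a *: f) = a * integ f.
Proof. by move=> If; rewrite /integ -RintegralZl. Qed.

Lemma integD f g : intble f -> intble g -> integ (f + g) = integ f + integ g.
Proof. by move=> If Ig; rewrite -[f]scale1r integP// mul1r scale1r. Qed.

Lemma integB f g : intble f -> intble g -> integ (f - g) = integ f - integ g.
Proof. by move=> If Ig; rewrite /integ -RintegralB. Qed.

Lemma integ_cst c : integ (cst c) = c.
Proof.
rewrite /integ Rintegral_cst// [X in fine X](_ : _ = 1%E) ?mulr1//.
exact: lebesgue01T.
Qed.

Lemma integ_le f g : intble f -> intble g -> (forall x, f x <= g x) ->
  integ f <= integ g.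
Proof. by move=> If Ig fg; apply: le_Rintegral. Qed.

Lemma integ_abs_le f : intble f -> `|integ f| <= integ (fun x => `|f x|).
Proof. by move=> If; exact: le_normr_Rintegral. Qed.

Lemma integ_bmeas_le B f : bmeas B f -> integ (fun x => `|f x|) <= B.
Proof.
move=> bf; rewrite -(integ_cst B); apply: integ_le.
- exact: intble_abs (bmeas_intble bf).
- exact: bmeas_intble (bmeas_cst B).
- by case: bf.
Qed.

End integration_on_unit_interval.

Section classes_of_functions.
Context {R : realType}.

Local Notation T := (measurableTypeR R).
Local Notation mu := (lebesgue01 R).
Implicit Types (f g : T -> R) (F G : L1 R).

Lemma intble_Lfun f : intble f -> f \in Lfun mu 1.
Proof. by move=> If; apply/Lfun1_integrable. Qed.

(** Total, so that the class of a product can be written without carrying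
    an integrability proof; the value is junk off integrable functions. *)
Definition cls f : L1 R :=
  if pselect (intble f) is left If
  then Lclass (Lfun_Sub (lexx 1%E) (intble_Lfun If)) else 0.

Definition rep F : T -> R := Lspace_repr F.

Lemma rep_intble F : intble (rep F).
Proof. by apply/Lfun1_integrable; exact: LfunP. Qed.

Lemma cls_rep F : cls (rep F) = F.
Proof.
rewrite /cls; case: pselect => [If|/(_ (rep_intble F))//].
rewrite -[RHS]Lclass_repr; apply/Lclass_eqP; exact: ae_eq_refl.
Qed.

Lemma rep_cls f : intble f -> rep (cls f) = f %[ae mu].
Proof.
move=> If; rewrite /cls; case: pselect => // If'; exact: Lspace_reprK.
Qed.

Lemma cls_ae f g : intble f -> intble g -> f = g %[ae mu] -> cls f = cls g.
Proof.
move=> If Ig fg; rewrite /cls; case: pselect => // If'; case: pselect => // Ig'.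
exact/Lclass_eqP.
Qed.

Lemma clsP a f g : intble f -> intble g -> cls (a *: f + g) = a *: cls f + cls g.
Proof.
move=> If Ig; have Ifg := intbleP a If Ig.
rewrite /cls; case: pselect => // Ifg'; case: pselect => // If'.
case: pselect => // Ig'.
set F := Lfun_Sub _ (intble_Lfun If'); set G := Lfun_Sub _ (intble_Lfun Ig').
transitivity (Lclass (a *: F + G)).
  by apply/Lclass_eqP; exact: ae_eq_refl.
symmetry; rewrite -LclassD -LclassZ; reflexivity.
Qed.

Lemma cls0 : cls 0 = 0.
Proof.
have I0 : intble (0 : T -> R) by exact: bmeas_intble (bmeas_cst 0).
have := clsP 1 I0 I0; rewrite !scale1r addr0 => /eqP.
by rewrite -subr_eq0 opprD addrA subrr sub0r oppr_eq0 => /eqP.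
Qed.

Lemma clsZ a f : intble f -> cls (a *: f) = a *: cls f.
Proof.
move=> If; have I0 : intble (0 : T -> R) by exact: bmeas_intble (bmeas_cst 0).
by have := clsP a If I0; rewrite cls0 !addr0.
Qed.

Lemma clsD f g : intble f -> intble g -> cls (f + g) = cls f + cls g.
Proof. by move=> If Ig; rewrite -[f]scale1r clsP// !scale1r. Qed.

Lemma clsB f g : intble f -> intble g -> cls (f - g) = cls f - cls g.
Proof. by move=> If Ig; rewrite addrC -scaleN1r clsP// scaleN1r addrC. Qed.

Lemma integ_ae f g : intble f -> intble g -> f = g %[ae mu] -> integ f = integ g.
Proof.
move=> If Ig fg; congr fine; apply: ae_eq_integral => //.
- apply/measurable_EFinP; exact: intble_meas If.
- apply/measurable_EFinP; exact: intble_meas Ig.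
- by apply: filterS fg => x /= /[apply] ->.
Qed.

Lemma norm_cls f : intble f -> `|cls f| = integ (fun x => `|f x|).
Proof.
move=> If; rewrite /cls; case: pselect => // If'.
rewrite [LHS]Lspace_normE Lnorm1 //.
Qed.

Definition pairing g F : R := integ (g * rep F).

Lemma pairing_cls B g f : bmeas B g -> intble f -> pairing g (cls f) = integ (g * f).
Proof.
move=> bg If; apply: integ_ae.
- exact: intbleM bg (rep_intble _).
- exact: intbleM bg If.
by apply: filterS (rep_cls If) => x /= h _; congr (_ * _); exact: h.
Qed.

Lemma pairingP B g a F G : bmeas B g ->
  pairing g (a *: F + G) = a * pairing g F + pairing g G.
Proof.
move=> bg; rewrite -[F]cls_rep -[G]cls_rep -clsP; [|exact: rep_intble..].
have IF := rep_intble F; have IG := rep_intble G.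
rewrite !(pairing_cls bg)//; last exact: intbleP.
rewrite -integP; [|exact: intbleM bg _..].
by congr integ; apply/funext => x; rewrite /= mulrDr; congr (_ + _);
   rewrite ![(_ *: _) _]/GRing.scale /= mulrCA.
Qed.

Lemma pairing_le B g F : bmeas B g -> `|pairing g F| <= B * `|F|.
Proof.
move=> bg; rewrite -[F]cls_rep; have IF := rep_intble F.
rewrite norm_cls// (pairing_cls bg)// (le_trans (integ_abs_le (intbleM bg IF)))//.
have -> : B * integ (fun x => `|rep F x|) = integ (B *: (fun x => `|rep F x|)).
  by rewrite integZ//; exact: intble_abs.
apply: integ_le.
- exact: intble_abs (intbleM bg IF).
- exact: intbleZ (intble_abs IF).
- by move=> x; rewrite [X in `|X|](_ : _ = g x * rep F x)// normrM ler_wpM2r//; case: bg.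
Qed.

End classes_of_functions.

(** * Dyadic step functions *)

Section dyadic_intervals.
Context {R : realType}.

Local Notation T := (measurableTypeR R).
Local Notation mu := (lebesgue01 R).

Definition dyad n i : set T := [set x : R | i%:R <= x * 2 ^+ n < i.+1%:R].

Lemma dyadE n i : dyad n i =
  [set` `[i%:R / 2 ^+ n, i.+1%:R / 2 ^+ n[] :> set R.
Proof.
apply/seteqP; split=> x /=; rewrite in_itv/= ler_pdivrMr ?ltr_pdivlMr//;
  by rewrite exprn_gt0.
Qed.

Lemma measurable_dyad n i : measurable (dyad n i).
Proof. rewrite dyadE; exact: measurable_itv. Qed.

Lemma dyad_half n i (b : bool) x :
  dyad n.+1 (i.*2 + b) x <-> dyad n i x /\
    b = (i.*2.+1%:R <= x * 2 ^+ n.+1) :> bool.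
Proof.
rewrite /dyad /= exprSr mulrA; set y := x * 2 ^+ n.
have s1 k : k.+1%:R = k%:R + 1 :> R by rewrite -natr1.
have e2 : i.*2%:R = i%:R * 2 :> R by rewrite -muln2 natrM.
have := s1 i; have := s1 i.*2; have := s1 i.*2.+1; rewrite e2 => e3 e4 e5.
split=> [/andP[h1 h2]|[/andP[h1 h2] ->]].
  case: b h1 h2; rewrite ?addn1 ?addn0 => h1 h2; split.
  - apply/andP; split; lra.
  - by rewrite h1.
  - rewrite e2 in h1; apply/andP; split; lra.
  - by apply/esym/negbTE; rewrite -ltNge.
by case: (leP i.*2.+1%:R (y * 2)) => h; rewrite ?addn1 ?addn0; apply/andP; split => //; lra.
Qed.

Lemma indic_dyad_half n i (x : T) :
  \1_(dyad n i) x = \1_(dyad n.+1 i.*2) x + \1_(dyad n.+1 i.*2.+1) x :> R.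
Proof.
have h0 := dyad_half n i false x; have h1 := dyad_half n i true x.
rewrite addn0 in h0; rewrite addn1 in h1.
have mE (A : set T) : (x \in A) = `[< A x >] by [].
have ind (P Q : Prop) (b c : bool) : (P <-> Q /\ b = c) -> `[< P >] = `[< Q >] && (b == c).
  move=> PQ; rewrite (asbool_equiv_eq PQ) asbool_and; congr andb.
  exact: (sameP (asboolP _) eqP).
rewrite !indicE !mE (ind _ _ _ _ h0) (ind _ _ _ _ h1).
by case: `[< _ >]; case: (_ <= _); rewrite /= ?addr0 ?add0r.
Qed.

Lemma sum_indic_dyad n N (x : T) :
  \sum_(i < N) \1_(dyad n i) x = (0 <= (x : R) * 2 ^+ n < N%:R)%R%:R :> R.
Proof.
elim: N => [|N IH].
  by rewrite big_ord0; case: leP => // h; rewrite ltNge h.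
rewrite big_ord_recr/= IH indicE.
have -> : (x \in dyad n N) = (N%:R <= (x : R) * 2 ^+ n < N.+1%:R).
  by apply/idP/idP => [/set_mem//|h]; exact: mem_set.
set y := _ * _.
have NS : N%:R < N.+1%:R :> R by rewrite ltr_nat.
have N0 : 0 <= N%:R :> R by [].
case: (leP 0 y) => y0; case: (ltP y N%:R) => yN; rewrite /= ?addr0 ?add0r//.
- by rewrite (lt_trans yN NS).
- by move: (lt_le_trans y0 N0); rewrite ltNge yN.
Qed.

Lemma mu_itv_le (A : set T) (a b : R) : a <= b -> measurable A ->
  A `<=` [set` `[a, b[] -> fine (mu A) <= b - a.
Proof.
move=> ab mA Aab; have : (mu A <= (b - a)%:E)%E.
  rewrite /= /mrestr; apply: (@le_trans _ _ (lebesgue_measure (`[a, b[%classic : set T))).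
    by apply: le_measure; rewrite ?inE//; [exact: measurableI|move=> x [] /Aab].
  rewrite lebesgue_measure_itv/=; case: ifPn => _; rewrite ?lee_fin ?subr_ge0//.
have mu0 : (0 <= mu A)%E by exact: measure_ge0.
by case: (mu A) mu0.
Qed.

Lemma integ_indic (A : set T) : measurable A -> integ \1_A = fine (mu A).
Proof. by move=> mA; rewrite /integ /Rintegral integral_indic// setIT. Qed.

Lemma integ_indic_dyad_le n i : integ \1_(dyad n i) <= 2 ^- n.
Proof.
have n0 : 0 < 2 ^+ n :> R by rewrite exprn_gt0.
rewrite integ_indic; last exact: measurable_dyad.
have -> : 2 ^- n = i.+1%:R / 2 ^+ n - i%:R / 2 ^+ n :> R.
  by rewrite -mulrBl -natrB// subSnn mul1r.
apply: mu_itv_le; first by rewrite ler_pM2r ?invr_gt0// ler_nat.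
  exact: measurable_dyad.
by rewrite dyadE.
Qed.

Lemma integ_indic_dyad n i : (i < 2 ^ n)%N -> integ \1_(dyad n i) = 2 ^- n.
Proof.
move=> ltin; have n0 : 0 < 2 ^+ n :> R by rewrite exprn_gt0.
rewrite integ_indic; last exact: measurable_dyad.
have -> : 2 ^- n = i.+1%:R / 2 ^+ n - i%:R / 2 ^+ n :> R.
  by rewrite -mulrBl -natrB// subSnn mul1r.
rewrite /= /mrestr setIidl.
  rewrite dyadE lebesgue_measure_itv/= lte_fin ltr_pM2r ?invr_gt0//.
  by rewrite ltr_nat ltnSn.
move=> x; rewrite dyadE /= !in_itv/= => /andP[h1 h2]; apply/andP; split.
  by apply: le_trans h1; rewrite divr_ge0// ltW.
rewrite ltW//; apply: (lt_le_trans h2); rewrite ler_pdivrMr// mul1r.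
by rewrite -natrX ler_nat.
Qed.

End dyadic_intervals.

Section dyadic_span.
Context {R : realType}.

Local Notation T := (measurableTypeR R).
Local Notation mu := (lebesgue01 R).
Implicit Types (F G : L1 R).

Lemma intble_indic (A : set T) : measurable A -> intble \1_A.
Proof. by move=> mA; exact: bmeas_intble (bmeas_indic mA). Qed.

Definition dyadcls n i : L1 R := cls \1_(dyad n i).

Lemma dyadcls_half n i : dyadcls n i = dyadcls n.+1 i.*2 + dyadcls n.+1 i.*2.+1.
Proof.
rewrite /dyadcls -clsD; [|exact: intble_indic (measurable_dyad _ _)..].
by congr cls; apply/funext => x; rewrite indic_dyad_half.
Qed.

Lemma norm_indic_cls (A : set T) : measurable A -> `|cls \1_A : L1 R| = fine (mu A).
Proof.
move=> mA; rewrite norm_cls ?integ_indic//; last exact: intble_indic.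
rewrite -integ_indic//; congr integ; apply/funext => x.
by rewrite ger0_norm.
Qed.

Lemma norm_dyadcls n i : `|dyadcls n i| <= 2 ^- n.
Proof.
rewrite norm_indic_cls -?integ_indic; [|exact: measurable_dyad..].
exact: integ_indic_dyad_le.
Qed.

Definition coef n i F : R := pairing \1_(dyad n i) F.

Lemma coefP n i a F G : coef n i (a *: F + G) = a * coef n i F + coef n i G.
Proof. exact: pairingP (bmeas_indic (measurable_dyad n i)). Qed.

Lemma coef_half n i F : coef n i F = coef n.+1 i.*2 F + coef n.+1 i.*2.+1 F.
Proof.
have bm k j := bmeas_indic (@measurable_dyad R k j).
rewrite -[F]cls_rep /coef !(pairing_cls (bm _ _)); [|exact: rep_intble..].
rewrite -integD; [|exact: intbleM (bm _ _) (rep_intble _)..].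
congr integ; rewrite -mulrDl; congr (_ * _); apply/funext => x.
by rewrite indic_dyad_half.
Qed.

Lemma sum_coef_le n N F : \sum_(i < N) `|coef n i F| <= `|F|.
Proof.
have bm k j := bmeas_indic (@measurable_dyad R k j).
have IF := rep_intble F.
rewrite -{2}[F]cls_rep norm_cls//.
pose h i : T -> R := fun x => \1_(dyad n i) x * `|rep F x|.
have Ih i : intble (h i) by exact: intbleM (bm _ _) (intble_abs IF).
have : \sum_(i < N) `|coef n i F| <= integ (\sum_(i < N) h i).
  suff [Is ->] : intble (\sum_(i < N) h i) /\
      integ (\sum_(i < N) h i) = \sum_(i < N) integ (h i).
    apply: ler_sum => i _.
    rewrite (le_trans (integ_abs_le (intbleM (bm _ _) IF)))//.
    apply: integ_le => //; first exact: intble_abs (intbleM (bm _ _) IF).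
    by move=> x; rewrite /h [X in `|X|](_ : _ = \1_(dyad n i) x * rep F x)// normrM ger0_norm.
  elim: N => [|N [IN EN]].
    rewrite !big_ord0; split; first exact: bmeas_intble (bmeas_cst 0).
    exact: (integ_cst 0).
  by rewrite !big_ord_recr/= -EN integD//; split => //; exact: intbleD.
move/le_trans; apply; apply: integ_le.
- by elim/big_ind : _ => //; [exact: bmeas_intble (bmeas_cst 0)|exact: intbleD].
- exact: intble_abs.
- move=> x; rewrite fct_sumE /h -mulr_suml sum_indic_dyad.
  by case: (_ && _); rewrite ?mul1r ?mul0r.
Qed.

Lemma coef_dyadcls n i j : (i < 2 ^ n)%N ->
  coef n i (dyadcls n j) = (i == j)%:R * 2 ^- n.
Proof.
move=> ltin; have bm k l := bmeas_indic (@measurable_dyad R k l).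
rewrite /coef (pairing_cls (bm _ _)); last exact: bmeas_intble (bm _ _).
have [<-|ij] := eqVneq i j.
  rewrite mul1r -(integ_indic_dyad ltin); congr integ; apply/funext => x.
  rewrite [LHS](_ : _ = \1_(dyad n i) x * \1_(dyad n i) x)// indicE.
  by case: (_ \in _); rewrite ?mul1r ?mul0r.
rewrite mul0r -(integ_cst 0); congr integ; apply/funext => x.
rewrite [LHS](_ : _ = \1_(dyad n i) x * \1_(dyad n j) x)// !indicE /cst.
case: (boolP (x \in dyad n i)) => [/set_mem/andP[h1 h2]|]; last by rewrite mul0r.
case: (boolP (x \in dyad n j)) => [/set_mem/andP[h3 h4]|]; last by rewrite mulr0.
have := le_lt_trans h1 h4; have := le_lt_trans h3 h2.
by rewrite !ltr_nat !ltnS => ji ij'; move: ij; rewrite eqn_leq ij' ji.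
Qed.

Definition dyadic_approximable F : Prop := forall r, 0 < r ->
  exists n S, lspan (2 ^ n) (dyadcls n) S /\ `|F - S| < r.

Lemma lspan_dyad_refine n k : lspan (2 ^ n) (dyadcls n) `<=`
  lspan (2 ^ (n + k)) (dyadcls (n + k)).
Proof.
elim: k => [|k IH]; first by rewrite addn0.
rewrite addnS; apply: subset_trans IH _; apply: lspan_sub => i lti.
rewrite dyadcls_half; apply: lspanD; apply: lspan_gen; rewrite expnS mul2n.
  by rewrite ltn_double.
by rewrite -doubleS leq_double.
Qed.

Lemma dyadic_approximableP a F G : dyadic_approximable F ->
  dyadic_approximable G -> dyadic_approximable (a *: F + G).
Proof.
move=> dF dG r r0; have a0 : 0 < 1 + `|a| by rewrite ltr_pwDl.
have r20 : 0 < r / 2 by rewrite divr_gt0.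
have [n [S [LS FS]]] := dF _ (divr_gt0 r20 a0).
have [m [S' [LS' GS]]] := dG _ r20.
exists (n + m)%N, (a *: S + S'); split.
  apply: lspanP; first exact: lspan_dyad_refine.
  by rewrite addnC; exact: lspan_dyad_refine.
rewrite opprD addrACA -scalerBr (le_lt_trans (ler_normD _ _))// normrZ (splitr r).
rewrite ler_ltD//; have := ltW FS; rewrite ler_pdivlMr// => /(le_trans _); apply.
by rewrite mulrC ler_wpM2l// lerDr.
Qed.

Lemma dyadic_approximable_closed F :
  (forall r, 0 < r -> exists G, dyadic_approximable G /\ `|F - G| < r) ->
  dyadic_approximable F.
Proof.
move=> h r r0; have r20 : 0 < r / 2 by rewrite divr_gt0.
have [G [dG FG]] := h _ r20; have [n [S [LS GS]]] := dG _ r20.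
exists n, S; split => //; rewrite -[F](subrK G) -addrA.
by rewrite (le_lt_trans (ler_normD _ _))// (splitr r) ltrD.
Qed.

Lemma dyadic_approximable0 : dyadic_approximable 0.
Proof.
move=> r r0; exists 0%N, 0; split; first exact: lspan0.
by rewrite subr0 normr0.
Qed.

Lemma dyadic_approximableB F G : dyadic_approximable F ->
  dyadic_approximable G -> dyadic_approximable (F - G).
Proof. by move=> dF dG; rewrite addrC -scaleN1r; exact: dyadic_approximableP. Qed.

End dyadic_span.

Section dyadic_density.
Import HBSimple.
Context {R : realType}.

Local Notation T := (measurableTypeR R).
Local Notation mu := (lebesgue01 R).
Implicit Types (F G : L1 R).

Lemma ae_unit_interval (P : T -> Prop) :
  (forall x : R, 0 <= x < 1 -> P x) -> {ae mu, forall x, P x}.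
Proof.
move=> hP; exists (~` [set` `[0, 1[] : set R); split.
- by apply: measurableC; exact: measurable_itv.
- rewrite /= /mrestr; apply/eqP; rewrite eq_le measure_ge0 andbT.
  rewrite -(@lebesgue_measure_set1 R 1).
  apply: le_measure; rewrite ?inE.
  + apply: measurableI; last exact: measurable_itv.
    by apply: measurableC; exact: measurable_itv.
  + exact: measurable_set1.
  + move=> x /= []; rewrite !in_itv/= => /negP.
    rewrite negb_and -!leNgt => /orP[|] h /andP[x0 x1].
      by move: h; rewrite -ltNge => /lt_le_trans/(_ x0); rewrite ltxx.
    by apply/eqP; rewrite eq_le x1.
- move=> x /= nP; rewrite in_itv/= => x01; apply: nP; exact: hP.
Qed.

(** The half-open interval is the union of the dyadic intervals of each level;
    its complement has measure zero. *)
Lemma cls_eq01 (f g : T -> R) : intble f -> intble g ->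
  (forall x : R, 0 <= x < 1 -> f x = g x) -> cls f = cls g :> L1 R.
Proof.
move=> If Ig fg; apply: cls_ae => //.
by apply: ae_unit_interval => x x01 _; exact: fg.
Qed.

Lemma cls_sum (I : Type) (s : seq I) (f : I -> T -> R) :
  (forall i, intble (f i)) ->
  intble (\sum_(i <- s) f i) /\ cls (\sum_(i <- s) f i) = \sum_(i <- s) cls (f i) :> L1 R.
Proof.
move=> If; elim: s => [|i s [IS ES]].
  by rewrite !big_nil cls0; split => //; exact: bmeas_intble (bmeas_cst 0).
by rewrite !big_cons -ES clsD//; split => //; exact: intbleD.
Qed.

Lemma dyad_eq n i j (x : T) : dyad n i x -> dyad n j x -> i = j.
Proof.
move=> /andP[h1 h2] /andP[h3 h4]; apply/eqP; rewrite eqn_leq.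
have := le_lt_trans h1 h4; have := le_lt_trans h3 h2.
by rewrite !ltr_nat !ltnS => -> ->.
Qed.

Lemma dyad_ex n (x : R) : 0 <= x < 1 -> exists2 i, (i < 2 ^ n)%N & dyad n i x.
Proof.
move=> /andP[x0 x1]; have n0 : 0 < 2 ^+ n :> R by rewrite exprn_gt0.
have h := truncn_itv (mulr_ge0 x0 (ltW n0)).
exists (Num.truncn (x * 2 ^+ n)) => //.
rewrite -(ltr_nat R); case/andP: h => h _; apply: (le_lt_trans h).
by rewrite natrX gtr_pMl.
Qed.

Lemma step_value n N (s : nat -> R) i (x : T) : (i < N)%N -> dyad n i x ->
  \sum_(j < N) s j * \1_(dyad n j) x = s i.
Proof.
move=> ltiN xi; rewrite (bigD1 (Ordinal ltiN))//= indicE mem_set// mulr1.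
rewrite big1 ?addr0// => j; rewrite -val_eqE /= => ji.
rewrite indicE memNset ?mulr0// => xj; move/eqP: ji; apply.
exact: dyad_eq xj xi.
Qed.

Lemma cls_step n (s : nat -> R) N :
  intble (fun x => \sum_(i < N) s i * \1_(dyad n i) x) /\
  cls (fun x => \sum_(i < N) s i * \1_(dyad n i) x) =
    \sum_(i < N) s i *: dyadcls n i :> L1 R.
Proof.
have Id i := intble_indic (@measurable_dyad R n i).
have := @cls_sum _ (index_enum 'I_N) (fun i : 'I_N => s i *: \1_(dyad n i))
  (fun i => intbleZ (s i) (Id i)).
have -> : \sum_(i < N) s i *: (\1_(dyad n i) : T -> R) =
  (fun x => \sum_(i < N) s i * \1_(dyad n i) x).
  by apply/funext => x; rewrite fct_sumE.
move=> [Is ->]; split => //; apply: eq_bigr => i _.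
by rewrite clsZ.
Qed.

(** A dyadic interval either lies on one side of [b] or contains it, and only
    one interval of each level contains it. *)
Lemma approximable_ray (b : R) : dyadic_approximable (cls \1_[set` `]-oo, b]]).
Proof.
set A : set T := [set` _]; have mA : measurable A by exact: measurable_itv.
move=> r r0; have [n _ hn] := near_infty_natSinv_expn_lt (PosNum r0).
have n0 : 0 < 2 ^+ n :> R by rewrite exprn_gt0.
pose s i : R := (i.+1%:R <= b * 2 ^+ n)%R%:R.
exists n, (\sum_(i < 2 ^ n) s i *: dyadcls n i); split; first by exists s.
pose k := Num.truncn (b * 2 ^+ n).
have [Is <-] := cls_step n s (2 ^ n).
have mAk : measurable (A `&` dyad n k).
  by apply: measurableI => //; exact: measurable_dyad.
have Ik := intble_indic mAk.
have -> : cls \1_A = cls ((fun x => \sum_(i < 2 ^ n) s i * \1_(dyad n i) x) +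
    \1_(A `&` dyad n k)) :> L1 R.
  apply: cls_eq01; [exact: intble_indic|exact: intbleD|move=> x x01].
  have [i lti xi] := dyad_ex n x01.
  rewrite [RHS](_ : _ = \sum_(i < 2 ^ n) s i * \1_(dyad n i) x +
    \1_(A `&` dyad n k) x)// (step_value _ lti xi) /s.
  have /andP[h1 h2] := xi.
  have x0 : 0 <= x * 2 ^+ n.
    by rewrite mulr_ge0 ?(ltW n0)//; case/andP: x01.
  have Ax : (x \in A) = (x * 2 ^+ n <= b * 2 ^+ n).
    rewrite ler_pM2r//; apply/idP/idP => [/set_mem|h]; last apply: mem_set;
    by rewrite /A /= in_itv.
  have kE : 0 <= b * 2 ^+ n -> dyad n k b by move=> b0; exact: truncn_itv.
  rewrite !indicE in_setI Ax; case: (leP i.+1%:R (b * 2 ^+ n)) => hi /=.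
    have xb : x * 2 ^+ n <= b * 2 ^+ n by rewrite ltW// (lt_le_trans h2 hi).
    rewrite xb memNset ?addr0//= => xk.
    have /kE/andP[_ h4] := le_trans x0 xb.
    have := le_lt_trans hi h4; rewrite (dyad_eq xi xk) ltr_nat.
    by rewrite ltnn.
  rewrite add0r; case: (leP (x * 2 ^+ n) (b * 2 ^+ n)) => //= xb.
  have bi : dyad n i b by apply/andP; split => //; exact: le_trans h1 xb.
  have bk := kE (le_trans x0 xb).
  by rewrite -(dyad_eq bi bk) mem_set.
rewrite clsD// addrC addKr norm_indic_cls// (@le_lt_trans _ _ (2 ^- n))//.
  rewrite (_ : 2 ^- n = k.+1%:R / 2 ^+ n - k%:R / 2 ^+ n); last first.
    by rewrite -mulrBl -natrB// subSnn mul1r.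
  apply: mu_itv_le => //; first by rewrite ler_pM2r ?invr_gt0// ler_nat.
  by rewrite -dyadE; exact: subIsetr.
by have := hn n (leqnn n); rewrite /= div1r.
Qed.

Lemma approximable_indic (A : set T) : measurable A -> dyadic_approximable (cls \1_A).
Proof.
pose H := [set A : set T | measurable A /\ dyadic_approximable (cls \1_A)].
move: A; suff HA : @measurable _ T `<=` H by move=> A /HA[].
have HD (A B : set T) : B `<=` A -> H A -> H B -> H (A `\` B).
  move=> BA [mA dA] [mB dB]; split; first exact: measurableD.
  rewrite (_ : \1_(A `\` B) = \1_A - \1_B :> (T -> R)).
    rewrite clsB; [|exact: intble_indic..]; exact: dyadic_approximableB.
  apply/funext => x; rewrite [RHS](_ : _ = \1_A x - \1_B x)// !indicE in_setD.
  case: (boolP (x \in B)) => [/set_mem/BA xA|_]; last by rewrite subr0 andbT.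
  by rewrite mem_set// subrr.
apply: (@lambda_system_subset _ (@ocitv R) _ setT) => //.
- exact: ocitvI.
- split=> //.
  + split => //.
    have -> : cls \1_setT = cls \1_(dyad 0 0) :> L1 R.
      apply: cls_eq01; [exact: intble_indic|exact: intble_indic (measurable_dyad 0 0)|].
      by move=> x x01; rewrite !indicE in_setT mem_set// /dyad /= expr0 mulr1.
    move=> r r0; exists 0%N, (dyadcls 0 0); rewrite subrr normr0; split => //.
    exact: lspan_gen.
  + move=> F ndF HF; have mF i : measurable (F i) by case: (HF i).
    have mU : measurable (\bigcup_i F i) by exact: bigcup_measurable.
    split => //; apply: dyadic_approximable_closed => r r0.
    have cF := @nondecreasing_cvg_mu _ T R mu F mF mU ndF.
    have muE (B : set T) : measurable B -> (fine (mu B))%:E = mu B.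
      move=> mB; rewrite fineK// ge0_fin_numE ?measure_ge0//.
      apply: (@le_lt_trans _ _ (mu setT)); last by rewrite lebesgue01T ltry.
      by apply: le_measure; rewrite ?inE.
    have /cvgrPdist_lt/(_ _ r0)[n _ hn] : fine \o (mu \o F) @ \oo --> fine (mu (\bigcup_i F i)).
      apply: fine_cvg; rewrite muE//; exact: cF.
    exists (cls \1_(F n)); split; first by case: (HF n).
    rewrite -clsB; [|exact: (intble_indic mU)|exact: (intble_indic (mF n))].
    have FU : F n `<=` \bigcup_i F i by exact: bigcup_sup.
    have -> : \1_(\bigcup_i F i) - \1_(F n) = \1_(\bigcup_i F i `\` F n) :> (T -> R).
      apply/funext => x; rewrite [LHS](_ : _ = \1_(\bigcup_i F i) x - \1_(F n) x)//.
      rewrite !indicE in_setD.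
      case: (boolP (x \in F n)) => [/set_mem/FU xA|_]; last by rewrite subr0 andbT.
      by rewrite mem_set// subrr.
    rewrite norm_indic_cls; last exact: (measurableD mU (mF n)).
    have := hn n (leqnn n); rewrite /=; apply: le_lt_trans.
    apply: le_trans (ler_norm _); rewrite -lee_fin EFinB !muE//; last exact: (measurableD mU (mF n)).
    rewrite measureD ?(setIidr FU)//.
      exact: mF n.
    by have := ltry (fine (mu (\bigcup_i F i))); rewrite (muE _ mU).
    exact: mF n.
- move=> _ [[a b] _ <-] /=; split; first exact: measurable_itv.
  have [ab|ba] := leP a b; last first.
    by rewrite set_itv_ge ?bnd_simp -?leNgt ?ltW// indic0 cls0; exact: dyadic_approximable0.
  rewrite (_ : [set` `]a, b]] = [set` `]-oo, b]] `\` [set` `]-oo, a]]).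
    apply HD => /=; [|split; [exact: measurable_itv|exact: approximable_ray]..].
    by move=> x /=; rewrite !in_itv/= => /le_trans; apply.
  apply/seteqP; split=> x /=; rewrite !in_itv/=.
    by move=> /andP[h1 h2]; split => //; apply/negP; rewrite -ltNge.
  by move=> [h1 /negP]; rewrite -ltNge h1 => ->.
Qed.

(** The measurable sets with approximable indicator form a lambda-system that
    contains the intervals, and simple functions are dense in [L1]. *)
Lemma dyadic_density F : dyadic_approximable F.
Proof.
rewrite -[F]cls_rep; have IF := rep_intble F; set f := rep F in IF *.
have [g_ [Ig _ cg]] := approximation_sfun_integrable measurableT IF.
apply: dyadic_approximable_closed => r r0.
have [n _ hn] : \forall n \near \oo, (\int[mu]_z `|(f z)%:E - (g_ n z)%:E| < r%:E)%E.
  move/fine_fcvg : cg => /cvgrPdist_lt/(_ _ r0)[n0 _ hn0]; exists n0 => // n /hn0 /=.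
  have Ifg : intble (f - (g_ n : T -> R)) by exact: (intbleB IF (Ig n)).
  rewrite sub0r normrN => h; rewrite -[ltLHS]fineK.
    by rewrite lte_fin; exact: le_lt_trans (ler_norm _) h.
  have := integrable_fin_num measurableT (integrable_abse Ifg); by [].
exists (cls (g_ n)); split; last first.
  rewrite -(clsB IF (Ig n)) (norm_cls (intbleB IF (Ig n))).
  have := hn n (leqnn n); rewrite /integ /Rintegral.
  set I := integral _ _ _ => h.
  suff : (0 <= I)%E by case: I h => //= x.
  exact: integral_ge0.
set gn := g_ n.
have -> : (gn : T -> R) = \sum_(i < #|` fset_set (gn @` setT)|)
    (fset_set (gn @` setT))`_i *: \1_(gn @^-1` [set (fset_set (gn @` setT))`_i]).
  by apply/funext => x; rewrite fimfunEord fct_sumE.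
set s := fset_set _.
have mg i : measurable (gn @^-1` [set s`_i]).
  rewrite -[X in measurable X]setTI.
  exact: (@measurable_funPT _ _ _ _ gn) (measurable_set1 _).
have Ii i : intble (s`_i *: (\1_(gn @^-1` [set s`_i]) : T -> R)).
  by apply: intbleZ; exact: intble_indic.
have [_ ->] := @cls_sum _ (index_enum 'I_#|` s|)
  (fun i : 'I__ => s`_i *: (\1_(gn @^-1` [set s`_i]) : T -> R)) (fun i => Ii i).
elim/big_ind : _ => [|G G' dG dG'|i _].
- exact: dyadic_approximable0.
- by rewrite -[G]scale1r; exact: dyadic_approximableP.
- rewrite clsZ; last exact: intble_indic.
  rewrite -[_ *: _]addr0; apply: dyadic_approximableP; last exact: dyadic_approximable0.
  exact: approximable_indic.
Qed.

End dyadic_density.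

(** * Uniform integrability of weakly null sequences *)

Section uniform_integrability.
Context {R : realType}.

Local Notation T := (measurableTypeR R).
Local Notation mu := (lebesgue01 R).
Implicit Types (F G : L1 R) (A : set T).

(** Bounded densities have weak-star limits: as a functional on [L1], the limit
    is defined pointwise along the ultrafilter, and no limit density has to be
    constructed. *)
Lemma pairing_ultra_limit (U : set_system nat) (g : nat -> T -> R) :
  UltraFilter U -> (forall m, bmeas 1 (g m)) ->
  exists phi : {linear L1 R -> R^o}, bounded_operator phi /\
    forall F, pairing (g m) F @[m --> U] --> (phi F : R).
Proof.
move=> UU bg.
have /choice[f fP] : forall F, exists l : R, pairing (g m) F @[m --> U] --> l.
  by move=> F; apply: (@bounded_ultra_cvg _ _ _ (1 * `|F|)) => m; exact: pairing_le.
have flin : linear (f : L1 R -> R^o).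
  move=> a F G; apply: (@norm_cvg_unique _ _ _ _ _ _ (fP _)) => /=.
  rewrite (_ : (fun m => _) = (fun m => a * pairing (g m) F + pairing (g m) G)).
    by apply: cvgD; [exact: cvgMr|exact: fP].
  by apply/funext => m; exact: pairingP.
pose phi : {linear L1 R -> R^o} := HB.pack f (GRing.isLinear.Build _ _ _ _ _ flin).
exists phi; split=> //; exists 1 => F.
have /cvg_norm h := fP F; apply: (cvgr_to_le h).
by apply: nearW => m; exact: pairing_le.
Qed.

Definition mass A F : R := integ (\1_A * (fun x => `|rep F x|)).

Lemma intble_mass A F : measurable A -> intble (\1_A * (fun x => `|rep F x|)).
Proof. by move=> mA; exact: intbleM (bmeas_indic mA) (intble_abs (rep_intble F)). Qed.

Lemma mass_continuous F (e : R) : 0 < e -> exists2 d, 0 < d &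
  forall A, measurable A -> fine (mu A) < d -> mass A F < e.
Proof.
move=> e0; have [d [d0 hd]] := integral_normr_continuous (rep_intble F) e0.
exists d => // A mA Ad; have := hd A mA.
rewrite /mass /integ Rintegral_mkcond.
have -> : (fun x => `|rep F x|) \_ A = \1_A * (fun x => `|rep F x|).
  apply/funext => x; rewrite patchE [RHS](_ : _ = \1_A x * `|rep F x|)// indicE.
  by case: (_ \in _); rewrite ?mul1r ?mul0r.
apply; rewrite -lte_fin fineK// in Ad.
rewrite ge0_fin_numE ?measure_ge0// (@le_lt_trans _ _ (mu setT))//.
  by apply: le_measure; rewrite ?inE.
by rewrite lebesgue01T ltry.
Qed.

(** There is no cancellation on the part of [A] where the function is
    nonnegative, nor on the part where it is negative, and one of the two
    carries half of the mass. *)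
Lemma mass_half A F : measurable A -> exists B, [/\ measurable B, B `<=` A &
  mass A F / 2 <= `|pairing \1_B F|].
Proof.
move=> mA; set f := rep F; have mf : measurable_fun setT f := intble_meas (rep_intble F).
pose P : set T := f @^-1` [set` `[0, +oo[].
have mP : measurable P by rewrite -[P]setTI; apply: mf => //; exact: measurable_itv.
pose B := A `&` P; pose C := A `\` P.
have mB : measurable B by exact: measurableI.
have mC : measurable C by exact: measurableD.
have bB := bmeas_indic mB; have bC := bmeas_indic mC.
have If := rep_intble F.
have E : mass A F = pairing \1_B F - pairing \1_C F.
  rewrite /mass /pairing -integB; [|exact: intbleM bB If|exact: intbleM bC If].
  congr integ; apply/funext => x.
  rewrite [LHS](_ : _ = \1_A x * `|f x|)//.
  rewrite [RHS](_ : _ = \1_B x * f x - \1_C x * f x)//.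
  rewrite !indicE /B /C in_setI in_setD.
  have -> : (x \in P) = (0 <= f x).
    by apply/idP/idP => [/set_mem|h]; [|apply: mem_set]; rewrite /P/= in_itv/= andbT.
  case: (x \in A); rewrite /= ?mul0r ?subr0//.
  case: (leP 0 (f x)) => h; rewrite ?mul1r ?mul0r ?subr0 ?sub0r.
    by rewrite ger0_norm.
  by rewrite ltr0_norm.
have [h|h] := leP (mass A F / 2) `|pairing \1_B F|.
  by exists B; split => //; exact: subIsetl.
exists C; split => //; first exact: subDsetl.
have := ler_norm (pairing \1_B F); have := ler_norm (- pairing \1_C F).
rewrite normrN; lra.
Qed.

Lemma mass_le A B F : measurable A -> measurable B -> A `<=` B -> mass A F <= mass B F.
Proof.
move=> mA mB AB; apply: integ_le; [exact: intble_mass..|move=> x].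
rewrite [leLHS](_ : _ = \1_A x * `|rep F x|)// [leRHS](_ : _ = \1_B x * `|rep F x|)//.
rewrite ler_wpM2r// !indicE; case: (boolP (x \in A)) => // /set_mem/AB/mem_set ->//.
Qed.

(** The basic move of the gliding hump: setting the density to [1] or to [-1] on
    a set where [F] has one sign, the two resulting pairings with [F] differ by
    twice the mass there, so one of them is large whatever the density was. *)
Lemma hump g A F : bmeas 1 g -> measurable A -> exists g',
  [/\ bmeas 1 g', mass A F / 2 <= `|pairing g' F| &
      forall G, `|pairing g' G - pairing g G| <= 2 * mass A G].
Proof.
move=> bg mA; have [B [mB BA AB]] := mass_half F mA.
have bB := bmeas_indic mB; have If := @rep_intble R.
pose gs (s : R) : T -> R := g + \1_B * (cst s - g).
have gsE s x : gs s x = if x \in B then s else g x.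
  rewrite [LHS](_ : _ = g x + \1_B x * (s - g x))// indicE.
  by case: ifP; rewrite ?mul1r ?mul0r ?addr0// addrC subrK.
have bgs s : `|s| <= 1 -> bmeas 1 (gs s).
  move=> s1; split; last first.
    by move=> x; rewrite gsE; case: ifP => // _; case: bg.
  have [mg _] := bg; apply: measurable_funD => //; apply: measurable_funM.
    by case: bB.
  by apply: measurable_funB.
have P G s : `|s| <= 1 -> pairing (gs s) G =
    (pairing g G - integ (\1_B * (g * rep G))) + s * pairing \1_B G.
  move=> s1; have IbG := intbleM bB (If G).
  have IbgG := intbleM bB (intbleM bg (If G)).
  rewrite /pairing -integB//; last exact: intbleM bg (If G).
  rewrite [RHS]addrC -integP//; last by apply: intbleB => //; exact: intbleM bg (If G).
  congr integ; apply/funext => x.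
  rewrite [RHS](_ : _ = s * (\1_B x * rep G x) + (g x * rep G x - \1_B x * (g x * rep G x)))//.
  rewrite [LHS](_ : _ = (g x + \1_B x * (s - g x)) * rep G x)//; ring.
have [s s1 hs] : exists2 s : R, `|s| <= 1 & mass A F / 2 <= `|pairing (gs s) F|.
  set c := pairing g F - integ (\1_B * (g * rep F)); set a := pairing \1_B F.
  have n1 : `|1 : R| <= 1 by rewrite normr1.
  have nN1 : `|- 1 : R| <= 1 by rewrite normrN1.
  have [h|h] := leP (mass A F / 2) `|pairing (gs 1) F|; first by exists 1.
  exists (-1) => //; move: h; rewrite !P// -/c -/a mul1r mulN1r => h.
  have := ler_normB (c + a) (c - a).
  have -> : c + a - (c - a) = a + a by ring.
  rewrite -mulr2n normrMn; move: AB; rewrite -/a; lra.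
exists (gs s); split => //; first exact: bgs.
move=> G; have -> : pairing (gs s) G - pairing g G = integ (\1_B * ((cst s - g) * rep G)).
  have Ib1 := intbleM (bgs _ s1) (If G); have Ib2 := intbleM bg (If G).
  rewrite /pairing -integB//; congr integ; apply/funext => x.
  rewrite [RHS](_ : _ = \1_B x * ((s - g x) * rep G x))//.
  rewrite [LHS](_ : _ = (g x + \1_B x * (s - g x)) * rep G x - g x * rep G x)//; ring.
have bsg : bmeas 2 (cst s - g).
  have [mg hg] := bg; split; first exact: measurable_funB.
  move=> x; rewrite [X in `|X|](_ : _ = s - g x)// (le_trans (ler_normB _ _))//.
  have := hg x; lra.
have II := intbleM bB (intbleM bsg (If G)).
apply: (le_trans (integ_abs_le II)).
apply: (@le_trans _ _ (2 * mass B G)); last by rewrite ler_pM2l//; exact: mass_le.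
rewrite /mass -integZ; last exact: intble_mass.
apply: integ_le; [exact: intble_abs|exact: intbleZ (intble_mass _ mB)|move=> x].
rewrite [leRHS](_ : _ = 2 * (\1_B x * `|rep G x|))//.
rewrite [X in `|X|](_ : _ = \1_B x * ((s - g x) * rep G x))// !normrM.
rewrite (ger0_norm (_ : 0 <= \1_B x))// mulrCA ler_wpM2r ?mulr_ge0//.
by case: bsg => _ /(_ x).
Qed.

End uniform_integrability.

Section weakly_null_sequences.
Context {R : realType}.

Local Notation T := (measurableTypeR R).
Local Notation mu := (lebesgue01 R).
Implicit Types (F G : L1 R) (A : set T) (u : nat -> L1 R).

Lemma mass_continuous_finite u K (e : R) : 0 < e -> exists2 d, 0 < d &
  forall A, measurable A -> fine (mu A) < d -> forall l, (l <= K)%N -> mass A (u l) < e.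
Proof.
move=> e0; elim: K => [|K [d d0 hd]].
  have [d d0 hd] := mass_continuous (u 0%N) e0; exists d => // A mA Ad l.
  by rewrite leqn0 => /eqP ->; exact: hd.
have [d' d'0 hd'] := mass_continuous (u K.+1) e0.
exists (Num.min d d'); first by rewrite lt_min d0.
move=> A mA; rewrite lt_min => /andP[Ad Ad'] l.
by rewrite leq_eqVlt => /predU1P[->|]; [exact: hd'|exact: hd].
Qed.

(** Gliding hump: otherwise humps carrying a fixed mass on smaller and smaller
    sets could be glued into one density that does not converge to zero along
    the sequence.  Each new set is so small that it hardly affects the pairings
    with the earlier terms. *)
Lemma weakly_null_uniformly_continuous u : weakly_converges_to u 0 ->
  forall e : R, 0 < e -> exists2 d, 0 < d &
    forall A, measurable A -> fine (mu A) < d -> forall k, mass A (u k) <= e.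
Proof.
move=> wu e e0; apply: contrapT => H.
have {}H d : 0 < d -> exists A k, [/\ measurable A, fine (mu A) < d & e < mass A (u k)].
  move=> d0; apply: contrapT => H'; apply: H; exists d => // A mA Ad k.
  by rewrite leNgt; apply/negP => eA; apply: H'; exists A, k.
(* The perturbations [t j] add up to at most [e / 4]. *)
pose t j : R := e / 4 * (2 ^- j - 2 ^- j.+1).
have t2 j : t j = e / 4 * 2 ^- j / 2.
  rewrite /t exprS invfM; field.
  by rewrite expf_neq0.
have t0 j : 0 < t j by rewrite t2 !mulr_gt0// invr_gt0 exprn_gt0.
have te j : t j / 2 <= e.
  have : 2 ^- j <= 1 :> R by rewrite invf_le1 ?exprn_gt0// exprn_ege1// ler1n.
  move/(ler_wpM2l (ltW e0)); rewrite t2; lra.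
have /choice[nx nxP] : forall jp : nat * ((T -> R) * nat), exists q : (T -> R) * nat,
    bmeas 1 jp.2.1 -> [/\ bmeas 1 q.1, (jp.2.2 < q.2)%N,
      e / 2 <= `|pairing q.1 (u q.2)| &
      forall l, (l <= jp.2.2)%N ->
        `|pairing q.1 (u l) - pairing jp.2.1 (u l)| <= t jp.1].
  move=> [j [g K]] /=.
  have [bg|nbg] := pselect (bmeas 1 g); last by exists (g, K).
  have [d d0 hd] := mass_continuous_finite u K (divr_gt0 (t0 j) (ltr0n _ 2)).
  have [A [k [mA Ad Ae]]] := H d d0.
  have [g' [bg' g'A g'g]] := hump (u k) bg mA.
  exists (g', k) => _ /=; split => //.
  - rewrite ltnNge; apply/negP => kK.
    by have := lt_trans Ae (hd A mA Ad k kK); rewrite ltNge te.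
  - by apply: le_trans g'A; rewrite ler_pM2r// ltW.
  - move=> l lK; apply: (le_trans (g'g _)).
    by have := hd A mA Ad l lK; lra.
(* [S j] holds the density after [j] humps and the index of the last one. *)
pose S := fix S j := if j is i.+1 then nx (i, S i) else (cst 0, 0%N).
have bS j : bmeas 1 (S j).1.
  elim: j => [|j IH] /=; last by have [] := nxP (j, S j) IH.
  by have := bmeas_cst (0 : R); rewrite normr0; exact: bmeas_le.
have SP j : [/\ ((S j).2 < (S j.+1).2)%N,
    e / 2 <= `|pairing (S j.+1).1 (u (S j.+1).2)| &
    forall l, (l <= (S j).2)%N ->
        `|pairing (S j.+1).1 (u l) - pairing (S j).1 (u l)| <= t j].
  by have [_ ? ? ?] := nxP (j, S j) (bS j); split.
have Sj j : (j <= (S j).2)%N.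
  by elim: j => // j IH; apply: leq_ltn_trans IH _; case: (SP j).
have Smono j i : ((S j).2 <= (S (j + i)%N).2)%N.
  elim: i => [|i IH]; first by rewrite addn0.
  by rewrite addnS (leq_trans IH)// ltnW//; case: (SP (j + i)%N).
have Sfar j i : `|pairing (S (j + i)%N).1 (u (S j).2) - pairing (S j).1 (u (S j).2)|
    <= e / 4 * (2 ^- j - 2 ^- (j + i)).
  elim: i => [|i IH]; first by rewrite addn0 [X in `|X|]subrr normr0 subrr mulr0.
  rewrite addnS; have [_ _ /(_ _ (Smono j i)) h] := SP (j + i)%N.
  rewrite -[X in `|X - _|](subrK (pairing (S (j + i)%N).1 (u (S j).2))) -addrA.
  rewrite (le_trans (ler_normD _ _))//; move: h IH; rewrite /t; lra.
have [U [UU ooU]] := free_ultrafilter.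
have [phi [bphi phiP]] := pairing_ultra_limit UU bS.
have := wu phi bphi; rewrite linear0 => /cvg_seqP/(_ (e / 8)).
case=> [|N hN]; first by rewrite divr_gt0.
have := hN (S N.+1).2 (leq_trans (leqnSn N) (Sj N.+1)); rewrite subr0.
have /cvg_norm h := phiP (u (S N.+1).2).
suff : e / 4 <= `|phi (u (S N.+1).2) : R|.
  by move=> h1 h2; have := le_lt_trans h1 h2; lra.
apply: (cvgr_to_ge h); apply: ooU; exists N.+1 => // m /= Nm.
rewrite -(subnKC Nm); set i := (m - N.+1)%N.
have [_ h1 _] := SP N; have h2 := Sfar N.+1 i.
have h3 : e / 4 * (2 ^- N.+1 - 2 ^- (N.+1 + i)) <= e / 4.
  rewrite -[leRHS]mulr1 ler_pM2l ?divr_gt0//.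
  have : 2 ^- N.+1 <= 1 :> R by rewrite invf_le1 ?exprn_gt0// exprn_ege1// ler1n.
  have : 0 <= 2 ^- (N.+1 + i) :> R by rewrite invr_ge0 exprn_ge0.
  lra.
have := ler_normB (pairing (S (N.+1 + i)%N).1 (u (S N.+1).2))
  (pairing (S (N.+1 + i)%N).1 (u (S N.+1).2) - pairing (S N.+1).1 (u (S N.+1).2)).
rewrite opprB addrC subrK; lra.
Qed.

Lemma norm_sum_mass n F : `|F| = \sum_(i < 2 ^ n) mass (dyad n i) F.
Proof.
have If := intble_abs (rep_intble F).
have Id i := intble_mass F (@measurable_dyad R n i).
rewrite -{1}[F]cls_rep norm_cls; last exact: rep_intble.
have : intble (\sum_(i < 2 ^ n) \1_(dyad n i) * (fun x => `|rep F x|)) /\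
    integ (\sum_(i < 2 ^ n) \1_(dyad n i) * (fun x => `|rep F x|)) =
    \sum_(i < 2 ^ n) mass (dyad n i) F.
  elim: (2 ^ n)%N => [|N [IN EN]].
    rewrite !big_ord0; split; first exact: bmeas_intble (bmeas_cst 0).
    exact: (integ_cst 0).
  rewrite !big_ord_recr/= -EN integD//; split => //; exact: intbleD.
move=> [Is <-]; apply: integ_ae => //; apply: ae_unit_interval => x x01 _.
rewrite fct_sumE -mulr_suml [LHS]/=.
have [i lti xi] := dyad_ex n x01.
have := step_value (fun=> 1) lti xi; under eq_bigr do rewrite mul1r.
by move=> ->; rewrite mul1r.
Qed.

(** The unit interval is the union of finitely many dyadic intervals of measure
    less than [d], and each of them carries mass at most [1]. *)
Lemma uniformly_continuous_bounded u (d : R) : 0 < d ->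
  (forall A, measurable A -> fine (mu A) < d -> forall k, mass A (u k) <= 1) ->
  exists2 B, 0 < B & forall k, `|u k| <= B.
Proof.
move=> d0 hd; have [n _ hn] := near_infty_natSinv_expn_lt (PosNum d0).
exists (2 ^ n)%:R => [|k]; first by rewrite ltr0n expn_gt0.
rewrite (norm_sum_mass n) -[leRHS]mulr1 mulr_natl -[X in _ *+ X](card_ord (2 ^ n)).
rewrite -sumr_const; apply: ler_sum => i _; apply: hd; first exact: measurable_dyad.
rewrite -integ_indic; last exact: measurable_dyad.
by rewrite integ_indic_dyad//; have := hn n (leqnn n); rewrite /= div1r.
Qed.

(** Uniform integrability of weakly null sequences: by Chebyshev's inequality
    the sets where the functions exceed a large [M] are uniformly small, hence
    so is the mass removed by truncating at [M]. *)
Lemma weakly_null_truncation u : weakly_converges_to u 0 ->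
  forall e : R, 0 < e -> exists2 M, 0 < M &
    forall k, exists v, bmeas M v /\ `|u k - cls v| <= e.
Proof.
move=> wu e e0.
have [d1 d10 hd1] := weakly_null_uniformly_continuous wu (@ltr01 R).
have [B B0 hB] := uniformly_continuous_bounded d10 hd1.
have [d d0 hd] := weakly_null_uniformly_continuous wu e0.
pose M := 2 * B / d; have M0 : 0 < M by rewrite !mulr_gt0 ?invr_gt0.
exists M => // k; set f := rep (u k); have If : intble f := rep_intble (u k).
have mf := intble_meas If.
pose A : set T := f @^-1` (~` [set` `[- M, M]]).
have mA : measurable A.
  rewrite -[A]setTI; apply: mf => //; apply: measurableC; exact: measurable_itv.
have AE x : (x \in A) = (M < `|f x|).
  have -> : (x \in A) = ~~ (`|f x| <= M).
    rewrite ler_norml; apply/idP/idP => [/set_mem h|h].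
      by apply/negP => h'; apply: h; rewrite /= in_itv/=.
    by apply: mem_set; rewrite /A /= in_itv/=; exact/negP.
  by rewrite -ltNge.
have bA := bmeas_indic mA.
have muA : fine (mu A) < d.
  rewrite -integ_indic//; have : M * integ \1_A <= B.
    apply: le_trans (hB k); rewrite -(cls_rep (u k)) norm_cls// -integZ; last exact: intble_indic.
    apply: integ_le; [exact: intbleZ (intble_indic mA)|exact: intble_abs|move=> x].
    rewrite [leLHS](_ : _ = M * \1_A x)// indicE AE -/f.
    by case: ltP => h /=; rewrite ?mulr1 ?mulr0//; exact: ltW.
  have -> : B = M * (d / 2) by rewrite /M; field; rewrite gt_eqF.
  by rewrite ler_pM2l// => /le_lt_trans; apply; lra.
pose v : T -> R := f - \1_A * f.
have IA := intbleM bA If.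
have vE x : v x = if M < `|f x| then 0 else f x.
  rewrite [LHS](_ : _ = f x - \1_A x * f x)// indicE AE.
  by case: ifP; rewrite ?mul1r ?subrr ?mul0r ?subr0.
exists v; split.
  split; first by apply: measurable_funB => //; apply: measurable_funM => //; case: bA.
  by move=> x; rewrite vE; case: ltP => // _; rewrite normr0 ltW.
rewrite -{1}[u k]cls_rep -/f -clsB//; last exact: intbleB.
rewrite /v opprB addrC subrK norm_cls//; apply: le_trans (hd A mA muA k).
rewrite le_eqVlt; apply/orP; left; apply/eqP; congr integ; apply/funext => x.
rewrite [LHS](_ : _ = `|\1_A x * f x|)// normrM.
by rewrite [RHS](_ : _ = \1_A x * `|f x|)// ger0_norm.
Qed.

End weakly_null_sequences.

(** * Operators that are not completely continuous *)

Section bounded_functions.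
Context {R : realType}.

Local Notation T := (measurableTypeR R).
Implicit Types (f g : T -> R) (phi : (T -> R) -> R).

(** A linear form on the bounded measurable functions, continuous for the
    supremum norm and extended arbitrarily to all functions. *)
Definition bounded_form phi : Prop :=
  (forall a B f B' g, bmeas B f -> bmeas B' g ->
     phi (a *: f + g) = a * phi f + phi g) /\
  exists2 c, 0 <= c & forall B f, bmeas B f -> `|phi f| <= c * B.

Lemma bmeas_ge0 B f : bmeas B f -> 0 <= B.
Proof. by move=> [_ /(_ 0)]; exact: le_trans. Qed.

Lemma bmeasD B f B' g : bmeas B f -> bmeas B' g -> bmeas (B + B') (f + g).
Proof.
by move=> bf bg; have := bmeasP 1 bf bg; rewrite normr1 mul1r scale1r.
Qed.

Lemma bmeasB B f B' g : bmeas B f -> bmeas B' g -> bmeas (B + B') (f - g).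
Proof.
move=> bf bg; have := bmeasP (-1) bg bf.
by rewrite normrN1 mul1r scaleN1r [- g + f]addrC [B' + B]addrC.
Qed.

Lemma bmeas0 : bmeas 0 (0 : T -> R).
Proof. by split=> [|x]; [exact: measurable_cst|rewrite normr0]. Qed.

Lemma bmeasZ a B f : bmeas B f -> bmeas (`|a| * B) (a *: f).
Proof. by move=> bf; have := bmeasP a bf bmeas0; rewrite !addr0. Qed.

Lemma formB phi B f B' g : bounded_form phi -> bmeas B f -> bmeas B' g ->
  phi (f - g) = phi f - phi g.
Proof.
move=> [lin _] bf bg; rewrite addrC -scaleN1r (lin _ _ _ _ _ bg bf).
by rewrite mulN1r addrC.
Qed.

Lemma formZ phi a B f : bounded_form phi -> bmeas B f -> phi (a *: f) = a * phi f.
Proof.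
move=> [lin _] bf.
have p0 : phi 0 = 0.
  by have := lin 1 _ _ _ _ bmeas0 bmeas0; rewrite scale1r addr0 mul1r; lra.
by have := lin a _ _ _ _ bf bmeas0; rewrite p0 !addr0.
Qed.

(** Forms are added one at a time: either the new form vanishes on the common
    kernel of the previous ones, and then it agrees on [g] and [f] as soon as
    they do, or some vector of that kernel adjusts its value alone. *)
Lemma small_correction (s : seq ((T -> R) -> R)) :
  (forall phi, phi \in s -> bounded_form phi) ->
  exists2 K, 0 <= K & forall B f (r : R), bmeas B f -> 0 <= r ->
    (forall phi, phi \in s -> `|phi f| <= r) ->
    exists g, bmeas (K * r) g /\ forall phi, phi \in s -> phi g = phi f.
Proof.
elim: s => [_|psi s IH sb].
  exists 0 => // B f r _ _ _; exists 0; rewrite mul0r; split => //; exact: bmeas0.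
have psib : bounded_form psi by apply: sb; rewrite mem_head.
have sb' phi : phi \in s -> bounded_form phi by move=> ps; apply: sb; rewrite in_cons ps orbT.
have [K K0 hK] := IH sb'.
have [van|nvan] := pselect (forall B h, bmeas B h -> (forall phi, phi \in s -> phi h = 0) -> psi h = 0).
  exists K => // B f r bf r0 hf.
  have [g [bg gf]] := hK B f r bf r0 (fun phi ps => hf phi (mem_behead (s := psi :: s) ps)).
  exists g; split=> // phi; rewrite in_cons => /predU1P[->|]; last exact: gf.
  apply/eqP; rewrite -subr_eq0 -(formB psib bg bf); apply/eqP.
  apply: van (bmeasB bg bf) _ => phi' ps.
  by rewrite (formB (sb' _ ps) bg bf) gf// subrr.
have {nvan}[h [Bh [bh hs h1]]] : exists h Bh, [/\ bmeas Bh h,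
    forall phi, phi \in s -> phi h = 0 & psi h = 1].
  apply: contrapT => H; apply: nvan => B h bh hs; apply: contrapT => /eqP ph.
  apply: H; exists ((psi h)^-1 *: h), (`|(psi h)^-1| * B); split.
  - exact: bmeasZ.
  - move=> phi ps; rewrite (formZ _ (sb' _ ps) bh). by rewrite (hs _ ps) mulr0.
  - by rewrite (formZ _ psib bh) mulVf.
have Bh0 := bmeas_ge0 bh.
have [plin [c c0 hc]] := psib.
exists (K + (1 + c * K) * Bh).
  by rewrite addr_ge0// mulr_ge0// addr_ge0// mulr_ge0.
move=> B f r bf r0 hf.
have [g [bg gf]] := hK B f r bf r0 (fun phi ps => hf phi (mem_behead (s := psi :: s) ps)).
pose a := psi f - psi g.
have ar : `|a| <= (1 + c * K) * r.
  rewrite (le_trans (ler_normB _ _))// mulrDl mul1r -mulrA lerD//.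
    by apply: hf; rewrite mem_head.
  exact: hc.
exists (a *: h + g); split.
  apply: bmeas_le (bmeasP a bh bg).
  by rewrite addrC mulrDl lerD2l mulrAC ler_wpM2r.
move=> phi; rewrite in_cons => /predU1P[->|ps].
  by rewrite (plin _ _ _ _ _ bh bg) h1 mulr1 /a subrK.
have [lin _] := sb' _ ps.
by rewrite (lin _ _ _ _ _ bh bg) (hs _ ps) mulr0 add0r gf.
Qed.

End bounded_functions.

Section not_completely_continuous.
Context {R : realType} {X : completeNormedModType R}.

Local Notation T := (measurableTypeR R).

Lemma weakly_null_witness (A : {linear L1 R -> X}) : ~ completely_continuous A ->
  exists (w : nat -> L1 R) (d : R),
    [/\ weakly_converges_to w 0, 0 < d & forall k, d <= `|A (w k)|].
Proof.
move=> nA.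
have {nA}[u [l [ul nAu]]] : exists u l, weakly_converges_to u l /\ ~ cvgn (fun n => A (u n)).
  apply: contrapT => H; apply: nA => u l ul; apply: contrapT => h.
  by apply: H; exists u, l.
have [d d0 hd] : exists2 d : R, 0 < d & forall N, exists2 n, (N <= n)%N & d <= `|A (u n) - A l|.
  apply: contrapT => H; apply: nAu; apply/cvg_ex; exists (A l).
  apply/cvg_seqP => r r0; apply: contrapT => H'; apply: H; exists r => // N.
  apply: contrapT => H''; apply: H'; exists N => n Nn.
  by rewrite ltNge; apply/negP => rn; apply: H''; exists n.
have /choice[n nP] : forall N, exists n, (N <= n)%N /\ d <= `|A (u n) - A l|.
  by move=> N; have [n Nn dn] := hd N; exists n.
exists (fun k => u (n k) - l), d; split => //.
- move=> phi bphi; rewrite linear0; apply/cvg_seqP => r r0.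
  have /cvg_seqP/(_ r r0)[N hN] := ul phi bphi; exists N => k Nk.
  rewrite subr0 linearB; apply: hN; apply: (leq_trans Nk); by case: (nP k).
- by move=> k; rewrite linearB; case: (nP k).
Qed.

(** Each form has a limit along the sequence in the ultrafilter, and finitely
    many sets of the ultrafilter have their intersection in it. *)
Lemma ultra_forms (U : set_system nat) (s : seq ((T -> R) -> R)) (v : nat -> T -> R) M r :
  UltraFilter U -> (forall phi, phi \in s -> bounded_form phi) ->
  (forall k, bmeas M (v k)) -> 0 < r ->
  exists2 J, U J & forall k k', J k -> J k' ->
    forall phi, phi \in s -> `|phi (v k - v k')| <= r.
Proof.
move=> UU sb bv r0; elim: s sb => [|phi s IH] sb.
  by exists setT; [exact: filterT|].
have [J UJ hJ] : exists2 J, U J & forall k k', J k -> J k' ->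
    forall phi, phi \in s -> `|phi (v k - v k')| <= r.
  by apply: IH => psi ps; apply: sb; rewrite in_cons ps orbT.
have bphi : bounded_form phi by apply: sb; rewrite mem_head.
have [_ [c _ hc]] := bphi.
have [l hl] := bounded_ultra_cvg UU (fun k => hc _ _ (bv k)).
have r20 : 0 < r / 2 by rewrite divr_gt0.
have /cvgrPdist_lt/(_ _ r20) hU := hl.
exists (J `&` [set k | `|l - phi (v k)| < r / 2]); first exact: filterI.
move=> k k' [Jk /= lk] [Jk' /= lk'] psi; rewrite in_cons => /predU1P[->|ps]; last exact: hJ.
rewrite (formB bphi (bv k) (bv k')).
have -> : phi (v k) - phi (v k') = (l - phi (v k')) - (l - phi (v k)) by ring.
by rewrite (le_trans (ler_normB _ _))// (splitr r) ltW// ltrD.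
Qed.

(** Suppose that for every [d] the operator is smaller than [d] on the unit ball
    of the common kernel of some finite list of forms.  Along a weakly null
    sequence, truncations on which the forms nearly agree then have close
    images; letting one of the two indices grow, weak lower semicontinuity of
    the norm makes the images themselves small. *)
Lemma large_on_kernels (A : {linear L1 R -> X}) : bounded_operator A ->
  ~ completely_continuous A -> exists2 d : R, 0 < d &
  forall s : seq ((T -> R) -> R), (forall phi, phi \in s -> bounded_form phi) ->
    exists f, [/\ bmeas 1 f, forall phi, phi \in s -> phi f = 0 & d <= `|A (cls f)|].
Proof.
move=> [C0 hC0] /weakly_null_witness[w [d0 [ww d00 hw]]].
pose C := 1 + `|C0|; have C0' : 0 < C by rewrite ltr_pwDl.
have hC F : `|A F| <= C * `|F|.
  rewrite (le_trans (hC0 F))// ler_wpM2r// /C (le_trans (ler_norm _))//.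
  by rewrite lerDr.
apply: contrapT => H.
have {}H d : 0 < d -> exists2 s : seq ((T -> R) -> R),
    (forall phi, phi \in s -> bounded_form phi) &
    forall f, bmeas 1 f -> (forall phi, phi \in s -> phi f = 0) -> `|A (cls f)| <= d.
  move=> dpos; apply: contrapT => H'; apply: H; exists d => // s sb.
  apply: contrapT => H''; apply: H'; exists s => // f bf sf.
  by rewrite leNgt; apply/negP => df; apply: H''; exists f; split => //; exact: ltW.
(* [e] is the truncation error and [r] the tolerance on the values of the
   forms: all four contributions to [A (w k) - A (w k')] in [close] are at
   most [d0 / 8]. *)
pose e := d0 / (8 * C); have e0 : 0 < e by rewrite divr_gt0// mulr_gt0.
have [M M0 /choice[v vP]] := weakly_null_truncation ww e0.
pose N := 2 * M + 1; have N0 : 0 < N by rewrite addr_gt0// mulr_gt0.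
have [s sb hs] := H (d0 / 8 / N) (divr_gt0 (divr_gt0 d00 (ltr0n _ 8)) N0).
have [K K0 hK] := small_correction sb.
pose D := 1 + K + C * K * 8 / d0.
have CK0 : 0 <= C * K * 8 / d0 by rewrite divr_ge0 ?(ltW d00)// !mulr_ge0// ltW.
have D0 : 0 < D by rewrite /D -addrA ltr_pwDl// addr_ge0.
pose r := D^-1; have r0 : 0 < r by rewrite invr_gt0.
have Kr : K * r <= 1 by rewrite /r ler_pdivrMr// mul1r /D; lra.
have CKr : C * (K * r) <= d0 / 8.
  rewrite mulrA /r ler_pdivrMr//.
  have -> : d0 / 8 * D = d0 / 8 * (1 + K) + C * K.
    by rewrite /D; field; rewrite gt_eqF.
  by rewrite lerDr mulr_ge0 ?divr_ge0 ?addr_ge0// ltW.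
have bv k : bmeas M (v k) by case: (vP k).
have [U [UU ooU]] := free_ultrafilter.
have [J UJ hJ] := ultra_forms UU sb bv r0.
have close k k' : J k -> J k' -> `|A (w k) - A (w k')| <= d0 / 2.
  move=> Jk Jk'; pose f := v k - v k'.
  have bf : bmeas (M + M) f by exact: bmeasB.
  have [g [bg gf]] := hK _ f r bf (ltW r0) (hJ k k' Jk Jk').
  have bfg : bmeas N (f - g).
    by apply: bmeas_le (bmeasB bf bg); rewrite /N; move: Kr; lra.
  have h1 : `|A (cls (f - g))| <= d0 / 8.
    have bn : bmeas 1 (N^-1 *: (f - g)).
      have := bmeasZ N^-1 bfg; rewrite ger0_norm ?invr_ge0 ?ltW// mulVf ?gt_eqF//.
    have := hs _ bn; rewrite clsZ; last exact: bmeas_intble bfg.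
    rewrite linearZ normrZ ger0_norm ?invr_ge0 ?(ltW N0)//.
    move=> h; have : N^-1 * `|A (cls (f - g))| <= d0 / 8 / N.
      apply: h => phi ps; rewrite (formZ _ (sb _ ps) bfg) (formB (sb _ ps) bf bg).
      by rewrite gf// subrr mulr0.
    by rewrite mulrC ler_pM2r ?invr_gt0.
  have Ig := bmeas_intble bg; have If := bmeas_intble bf.
  have h2 : `|A (cls g)| <= d0 / 8.
    apply: le_trans (le_trans (hC _) _) CKr; rewrite ler_pM2l//.
    by rewrite norm_cls//; exact: integ_bmeas_le.
  have h3 : `|A (cls f)| <= d0 / 4.
    have -> : A (cls f) = A (cls (f - g)) + A (cls g).
      by rewrite clsB// linearB subrK.
    apply: le_trans (ler_normD _ _) _; lra.
  have h4 i : `|A (w i) - A (cls (v i))| <= d0 / 8.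
    rewrite -linearB (le_trans (hC _))//; have [_ h] := vP i.
    have -> : d0 / 8 = C * e by rewrite /e; field; rewrite gt_eqF.
    by rewrite ler_pM2l.
  have -> : A (w k) - A (w k') = (A (w k) - A (cls (v k))) +
     (A (cls f) - (A (w k') - A (cls (v k')))).
    rewrite /f clsB; [|exact: bmeas_intble (bv _)..].
    by rewrite linearB opprB [X in _ = _ + X]addrA subrK addrA subrK.
  have := ler_normD (A (w k) - A (cls (v k))) (A (cls f) - (A (w k') - A (cls (v k')))).
  have := ler_normB (A (cls f)) (A (w k') - A (cls (v k'))).
  have := h4 k; have := h4 k'; lra.
have [k0 Jk0] := ultra_ex UU UJ.
(* Weak lower semicontinuity: the functional norming [A (w k0)] is small at
   [A (w k)] for large [k]. *)
have [psi [psi1 psiE]] := norming_functional (A (w k0)).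
pose phi : {linear L1 R -> R^o} := psi \o A.
have bphi : bounded_operator phi.
  by exists C => F; rewrite (le_trans (psi1 _)).
have := ww phi bphi; rewrite linear0 => /cvg_seqP/(_ (d0 / 2)).
case=> [|n hn]; first by rewrite divr_gt0.
have [k [Jk nk]] : exists k, J k /\ (n <= k)%N.
  by apply: (ultra_ex UU); apply: filterI => //; apply: ooU; exists n.
have h1 := close k0 k Jk0 Jk; have h2 := hn k nk; rewrite subr0 in h2.
have := psi1 (A (w k0) - A (w k)); rewrite linearB psiE.
have := hw k0; move: h2; rewrite /phi /= => h2 h3 h4.
have := le_trans (ler_norm _) (le_trans h4 h1).
have := le_lt_trans (ler_norm _) h2.
move: h3; set x := `|A (w k0)|; set y := psi _; move=> h3 h5 h6.
have h5' : (y : R) < d0 / 2 := h5; have h6' : x - (y : R) <= d0 / 2 := h6.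
lra.
Qed.

End not_completely_continuous.

(** * Riesz products and the tree *)

Section riesz_products.
Context {R : realType} {X : completeNormedModType R}.

Local Notation T := (measurableTypeR R).
Implicit Types (f g : T -> R) (s : seq (T -> R)).

Lemma big_ord_double (V : nmodType) (G : nat -> V) N :
  \sum_(i < N.*2) G i = \sum_(i < N) (G i.*2 + G i.*2.+1).
Proof.
elim: N => [|N IH]; first by rewrite !big_ord0.
by rewrite doubleS !big_ord_recr/= IH addrA.
Qed.

Lemma big_ord_half (V : nmodType) (G : nat -> V) n :
  \sum_(i < 2 ^ n.+1) G i = \sum_(i < 2 ^ n) (G i.*2 + G i.*2.+1).
Proof. by rewrite expnS mul2n big_ord_double. Qed.

Lemma half_lt n i : (i < 2 ^ n.+1)%N -> (i./2 < 2 ^ n)%N.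
Proof. by rewrite expnS mul2n ltn_half_double. Qed.

Lemma mul_scale_fct g a f : g * (a *: f) = a *: (g * f).
Proof.
apply/funext => x; rewrite [LHS](_ : _ = g x * (a * f x))//.
by rewrite [RHS](_ : _ = a * (g x * f x))// mulrCA.
Qed.

(** The partial Riesz products [prod_k (1 +- f_k)] over a list of functions
    written newest first, the signs being the binary digits of [i]. *)
Fixpoint riesz s i : T -> R :=
  if s is f :: s' then riesz s' i./2 * (1 + (-1) ^+ odd i *: f) else 1.

Lemma riesz_cons f s i : riesz (f :: s) i =
  riesz s i./2 + (-1) ^+ odd i *: (riesz s i./2 * f).
Proof. by rewrite /= mulrDr mulr1 mul_scale_fct. Qed.

Lemma bmeas1 : bmeas 1 (1 : T -> R).
Proof. by split=> [|x]; [exact: measurable_cst|rewrite normr1]. Qed.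

Lemma bmeas_riesz s i : (forall f, f \in s -> bmeas 1 f) ->
  bmeas (2 ^+ size s) (riesz s i).
Proof.
elim: s i => [|f s IH] i hs; first by rewrite expr0; exact: bmeas1.
rewrite exprSr; apply: bmeasM.
  by apply: IH => g gs; apply: hs; rewrite in_cons gs orbT.
have bf : bmeas 1 f by apply: hs; rewrite mem_head.
by apply: bmeas_le (bmeasD bmeas1 (bmeasZ ((-1) ^+ odd i) bf)); rewrite normr_sign mul1r.
Qed.

Lemma riesz_ge0 s i x : (forall f, f \in s -> bmeas 1 f) -> 0 <= riesz s i x.
Proof.
elim: s i => [|f s IH] i hs; first exact: ler01.
rewrite [leRHS](_ : _ = riesz s i./2 x * (1 + (-1) ^+ odd i * f x))//.
rewrite mulr_ge0//; first by apply: IH => g gs; apply: hs; rewrite in_cons gs orbT.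
have [|_ /(_ x)] := hs f; first exact: mem_head.
by rewrite ler_norml => /andP[]; case: odd; rewrite ?expr0 ?expr1; lra.
Qed.

Lemma sum_riesz s x : \sum_(i < 2 ^ size s) riesz s i x = 2 ^+ size s.
Proof.
elim: s => [|f s IH]; first by rewrite /= expn0 big_ord_recr big_ord0/= add0r.
rewrite [size _]/= (big_ord_half (fun i => riesz (f :: s) i x)).
rewrite exprSr -IH mulr_suml; apply: eq_bigr => i _.
rewrite [X in X + _](_ : _ = riesz s i.*2./2 x * (1 + (-1) ^+ odd i.*2 * f x))//.
rewrite [X in _ + X](_ : _ = riesz s i.*2.+1./2 x * (1 + (-1) ^+ odd i.*2.+1 * f x))//.
rewrite doubleK -[i.*2.+1./2]/(uphalf i.*2) uphalf_double [odd i.*2.+1]/= odd_double /= expr0 expr1; ring.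
Qed.

Lemma operator_form (phi : X -> R) (A : {linear L1 R -> X}) (C B : R) g :
  contractive_functional phi -> (forall F, `|A F| <= C * `|F|) -> 0 <= C ->
  bmeas B g -> bounded_form (fun f => phi (A (cls (g * f)))).
Proof.
move=> [plin ple] hC C0 bg; split.
  move=> a B1 f B2 h bf bh.
  have If := bmeas_intble (bmeasM bg bf); have Ih := bmeas_intble (bmeasM bg bh).
  rewrite mulrDr mul_scale_fct clsP// linearP; exact: plin.
exists (C * B); first by rewrite mulr_ge0//; exact: bmeas_ge0 bg.
move=> B' f bf; rewrite (le_trans (ple _))// (le_trans (hC _))// -mulrA ler_wpM2l//.
have bgf := bmeasM bg bf.
by rewrite norm_cls; [exact: integ_bmeas_le|exact: bmeas_intble bgf].
Qed.

Lemma integral_form B g : bmeas B g -> bounded_form (fun f => integ (g * f)).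
Proof.
move=> bg; split.
  move=> a B1 f B2 h bf bh.
  have If := bmeas_intble (bmeasM bg bf); have Ih := bmeas_intble (bmeasM bg bh).
  by rewrite mulrDr mul_scale_fct integP.
exists B; first exact: bmeas_ge0 bg.
move=> B' f bf; have bgf := bmeasM bg bf.
rewrite (le_trans (integ_abs_le (bmeas_intble bgf)))//; exact: integ_bmeas_le.
Qed.

(** A bounded dyadic tree [x] in the Banach space, with differences [dx], whose
    levels of differences almost form a monotone decomposition and whose
    Rademacher averages stay away from zero. *)
Record rademacher_tree (C d eps : R) (x dx : nat -> nat -> X) : Prop := {
  tree_bounded : forall n i, (i < 2 ^ n)%N -> `|x n i| <= C;
  tree_step : forall n i, x n.+1 i = x n i./2 + (-1) ^+ odd i *: dx n i./2;
  tree_monotone : forall n m y (z : nat -> X), lspan (2 ^ n) (x n) y ->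
    (forall k, lspan (2 ^ k) (dx k) (z k)) -> (n <= m)%N ->
    `|y| <= (1 + eps) * `|y + \sum_(n <= k < m) z k|;
  tree_separated : forall n, d <= `|2 ^- n *: \sum_(i < 2 ^ n) dx n i|
}.

(** The tree is the image of Riesz products of functions [f_n] chosen one after
    the other: [f_n] is orthogonal to the previous products, so that the
    products stay of norm one, and the new differences are killed by functionals
    nearly norming the previous levels. *)
Lemma rademacher_tree_exists (A : {linear L1 R -> X}) (eps : R) : 0 < eps ->
  bounded_operator A -> ~ completely_continuous A ->
  exists C d x dx, [/\ 0 < C, 0 < d & rademacher_tree C d eps x dx].
Proof.
move=> eps0 bA nA; have [d d0 hd] := large_on_kernels bA nA.
have [C [C0 hC]] : exists C, 0 < C /\ forall F, `|A F| <= C * `|F|.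
  have [C0 hC0] := bA; exists (1 + `|C0|); split; first by rewrite ltr_pwDl.
  move=> F; rewrite (le_trans (hC0 F))// ler_wpM2r// (le_trans (ler_norm _))//.
  by rewrite lerDr.
pose img s i : X := A (cls (riesz s i)).
have /choice[N NP] : forall s, exists N : seq (X -> R),
    (forall phi, phi \in N -> contractive_functional phi) /\
    forall y z, lspan (2 ^ size s) (img s) y -> (forall phi, phi \in N -> phi z = 0) ->
      `|y| <= (1 + eps) * `|y + z|.
  by move=> s; exact: almost_orthogonal.
(* The functionals attached to a state are those norming the current level and
   all the previous ones, so that new differences are killed by all of them. *)
pose allN := fix allN s := N s ++ (if s is _ :: s' then allN s' else [::]).
have allNP s phi : phi \in allN s -> contractive_functional phi.
  elim: s => [|f s IH] /=; rewrite mem_cat.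
    by rewrite in_nil orbF; case: (NP [::]) => + _; apply.
  by move=> /orP[|//]; case: (NP (f :: s)) => + _; apply.
pose forms s : seq ((T -> R) -> R) :=
  [seq (fun f => phi (A (cls (riesz s i * f)))) | phi <- allN s, i <- iota 0 (2 ^ size s)]
  ++ [seq (fun f => integ (riesz s i * f)) | i <- iota 0 (2 ^ size s)].
have /choice[nx nxP] : forall s, exists f, (forall g, g \in s -> bmeas 1 g) ->
    [/\ bmeas 1 f, forall phi, phi \in forms s -> phi f = 0 & d <= `|A (cls f)|].
  move=> s; have [hs|nhs] := pselect (forall g, g \in s -> bmeas 1 g); last by exists 0.
  have [|f fP] := hd (forms s); last by exists f.
  move=> phi; rewrite mem_cat => /orP[/allpairsP[[psi i] /= [psis _ ->]]|/mapP[i _ ->]].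
    exact: operator_form (allNP _ _ psis) hC (ltW C0) (bmeas_riesz i hs).
  exact: integral_form (bmeas_riesz i hs).
pose S := fix S n := if n is m.+1 then nx (S m) :: S m else [::].
have sS n : size (S n) = n by elim: n => //= n ->.
have bS n g : g \in S n -> bmeas 1 g.
  elim: n g => [|n IH] g //=; rewrite in_cons => /predU1P[->|]; last exact: IH.
  by have [] := nxP (S n) IH.
pose f n := nx (S n).
have fP n : [/\ bmeas 1 (f n), forall phi, phi \in forms (S n) -> phi (f n) = 0 &
    d <= `|A (cls (f n))|] by exact: (nxP (S n) (bS n)).
pose W n := riesz (S n).
have bW n i : bmeas (2 ^+ n) (W n i) by rewrite -[in 2 ^+ n](sS n); exact: bmeas_riesz (bS n).
have bWf n i : bmeas (2 ^+ n * 1) (W n i * f n).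
  by apply: bmeasM; [exact: bW|case: (fP n)].
have IW n i := bmeas_intble (bW n i); have IWf n i := bmeas_intble (bWf n i).
pose x n i := A (cls (W n i)); pose dx n i := A (cls (W n i * f n)).
have Wint n i : (i < 2 ^ n)%N -> integ (W n i) = 1.
  elim: n i => [|n IH] i lti; first exact: (integ_cst 1).
  rewrite /W /= mulrDr mulr1 mul_scale_fct integD; [|exact: IW|exact: intbleZ (IWf _ _)].
  rewrite IH ?half_lt// integZ; last exact: IWf.
  have [_ fk _] := fP n.
  rewrite (fk (fun f => integ (riesz (S n) i./2 * f))) ?mulr0 ?addr0//.
  rewrite mem_cat; apply/orP; right; apply/mapP; exists i./2 => //.
  by rewrite mem_iota add0n leq0n sS half_lt.
have xs n i : x n.+1 i = x n i./2 + (-1) ^+ odd i *: dx n i./2.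
  rewrite /x /W [S n.+1]/= riesz_cons clsD; [|exact: IW|exact: intbleZ (IWf _ _)].
  by rewrite clsZ; [rewrite linearD linearZ|exact: IWf].
have kill n m phi i : (n <= m)%N -> phi \in N (S n) -> (i < 2 ^ m)%N -> phi (dx m i) = 0.
  move=> nm phiN lti.
  have phiA : phi \in allN (S m).
    rewrite -(subnKC nm); elim: (m - n)%N => [|k IH]; last first.
      by rewrite addnS /= mem_cat IH orbT.
    by rewrite addn0; case: (S n) phiN => [|g s] /=; rewrite mem_cat => ->.
  have [_ fk _] := fP m.
  apply: (fk (fun f => phi (A (cls (riesz (S m) i * f))))).
  rewrite mem_cat; apply/orP; left; apply/allpairsP; exists (phi, i); split => //=.
  by rewrite mem_iota add0n leq0n sS.
exists C, d, x, dx; split => //; split => //.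
- move=> n i lti; rewrite (le_trans (hC _))// norm_cls//.
  rewrite (_ : (fun y => _) = W n i) ?Wint ?mulr1//.
  apply/funext => y; rewrite ger0_norm//; exact: riesz_ge0 (bS n).
- move=> n m y z Yy hz nm; have [NC Nb] := NP (S n).
  apply: Nb; first by rewrite sS.
  move=> phi phiN; have [plin _] := NC _ phiN.
  have pD u v : phi (u + v) = phi u + phi v.
    by have := plin 1 u v; rewrite !scale1r.
  have p0 : phi 0 = 0 by have := pD 0 0; rewrite addr0; lra.
  have pZ b u : phi (b *: u) = b * phi u.
    by have := plin b u 0; rewrite !addr0 p0 addr0.
  rewrite big_nat; elim/big_ind : _ => //; first by move=> u v hu hv; rewrite pD hu hv addr0.
  move=> k /andP[nk _]; have [a ->] := hz k.
  elim/big_ind : _ => //; first by move=> u v hu hv; rewrite pD hu hv addr0.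
  by move=> i _; rewrite pZ (kill n k)// mulr0.
- move=> n; have [_ _] := fP n; suff -> : \sum_(i < 2 ^ n) dx n i = 2 ^+ n *: A (cls (f n)).
    by rewrite scalerA mulVf ?scale1r// expf_neq0.
  have If : intble (f n) by have [bf _ _] := fP n; exact: bmeas_intble bf.
  have [_ h] := @cls_sum _ _ (index_enum 'I_(2 ^ n)) (fun i : 'I_(2 ^ n) => W n i * f n)
     (fun i => IWf n i).
  have hS y := sum_riesz (S n) y; rewrite sS in hS.
  rewrite /dx -linear_sum -linearZ -clsZ// -h; congr (A (cls _)).
  rewrite -mulr_suml; apply/funext => y.
  rewrite [RHS](_ : _ = 2 ^+ n * f n y)// -(hS y).
  by rewrite [LHS](_ : _ = (\sum_(i < 2 ^ n) W n i) y * f n y)// fct_sumE.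
Qed.

End riesz_products.

(** * Rademacher functions are weakly null *)

Section rademacher_functions.
Context {R : realType}.

Definition rademacher n : L1 R :=
  \sum_(i < 2 ^ n.+1) (-1) ^+ odd i *: dyadcls n.+1 i.

Lemma coef_sum n i (I : Type) (s : seq I) (P : pred I) (F : I -> L1 R) :
  coef n i (\sum_(j <- s | P j) F j) = \sum_(j <- s | P j) coef n i (F j).
Proof.
have c0 : coef n i (0 : L1 R) = 0.
  by have := coefP n i 1 (0 : L1 R) 0; rewrite scale1r addr0 mul1r; lra.
apply: (big_morph _ _ c0) => F1 F2.
by have := coefP n i 1 F1 F2; rewrite scale1r mul1r.
Qed.

Lemma coefZ n i a (F : L1 R) : coef n i (a *: F) = a * coef n i F.
Proof.
have := coefP n i a F 0; have := coefP n i 1 (0 : L1 R) 0.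
rewrite scale1r !addr0 mul1r => h ->.
have -> : coef n i (0 : L1 R) = 0 by lra.
by rewrite addr0.
Qed.

Lemma coef_step n i (s : nat -> R) : (i < 2 ^ n)%N ->
  coef n i (\sum_(j < 2 ^ n) s j *: dyadcls n j) = s i * 2 ^- n.
Proof.
move=> lti; rewrite coef_sum (bigD1 (Ordinal lti))//= coefZ coef_dyadcls// eqxx mul1r.
rewrite big1 ?addr0// => j; rewrite -val_eqE /= => ji.
by rewrite coefZ coef_dyadcls// eq_sym (negbTE ji) mul0r mulr0.
Qed.

(** The values of [\sum_(n < N) a n *: rademacher n] on dyadic intervals. *)
Fixpoint signed_sum (a : nat -> R) N (i : nat) : R :=
  if N is N'.+1 then signed_sum a N' i./2 + (-1) ^+ odd i * a N' else 0.

Lemma sum_rademacherE (a : nat -> R) N : \sum_(n < N) a n *: rademacher n =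
  \sum_(i < 2 ^ N) signed_sum a N i *: dyadcls N i.
Proof.
elim: N => [|N IH].
  by rewrite big_ord0 big1// => i _; rewrite scale0r.
rewrite big_ord_recr/= IH /rademacher scaler_sumr.
rewrite (big_ord_half (fun i => a N *: ((-1) ^+ odd i *: dyadcls N.+1 i))).
rewrite (big_ord_half (fun i => (signed_sum a N i./2 + (-1) ^+ odd i * a N) *: dyadcls N.+1 i)).
rewrite -big_split; apply: eq_bigr => i _ /=.
rewrite doubleK uphalf_double odd_double /= expr0 expr1.
rewrite dyadcls_half scalerDr !scalerA !scalerDl mulr1 mul1r mulrC.
by rewrite [LHS]addrACA.
Qed.

Lemma sum_signed_sum (a : nat -> R) N :
  \sum_(i < 2 ^ N) signed_sum a N i ^+ 2 = 2 ^+ N * \sum_(n < N) a n ^+ 2.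
Proof.
elim: N => [|N IH]; first by rewrite big1 ?big_ord0 ?mulr0// => i _; rewrite expr0n.
rewrite (big_ord_half (fun i => signed_sum a N.+1 i ^+ 2)).
rewrite big_ord_recr/= exprS mulrDr -mulrA -IH.
rewrite (_ : 2 * 2 ^+ N * a N ^+ 2 = \sum_(i < 2 ^ N) 2 * a N ^+ 2); last first.
  by rewrite sumr_const card_ord -[RHS]mulr_natl natrX mulrAC mulrC mulrA.
rewrite mulr_sumr -big_split; apply: eq_bigr => i _ /=.
rewrite doubleK uphalf_double odd_double /= expr0 expr1.
ring.
Qed.

Lemma norm_step_le n (s : nat -> R) :
  `|\sum_(i < 2 ^ n) s i *: (dyadcls n i : L1 R)| <= 2 ^- n * \sum_(i < 2 ^ n) `|s i|.
Proof.
rewrite (le_trans (ler_norm_sum _ _ _))// mulr_sumr; apply: ler_sum => i _.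
by rewrite normrZ mulrC ler_wpM2r// norm_dyadcls.
Qed.

(** The values [s] of the sum on the dyadic intervals satisfy
    [|s| <= s ^+ 2 / (2 * c) + c / 2], and their squares average to the sum of
    the squares of the coefficients. *)
Lemma sum_rademacher_le (a : nat -> R) N (c : R) : 0 < c ->
  `|\sum_(n < N) a n *: rademacher n| <= (\sum_(n < N) a n ^+ 2) / (2 * c) + c / 2.
Proof.
move=> c0; rewrite sum_rademacherE (le_trans (norm_step_le _ _))//.
have n0 : 0 < 2 ^+ N :> R by rewrite exprn_gt0.
rewrite ler_pdivrMl// mulrDr mulrA -sum_signed_sum.
have -> : 2 ^+ N * (c / 2) = \sum_(i < 2 ^ N) c / 2.
  by rewrite sumr_const card_ord -[RHS]mulr_natl natrX.
rewrite mulr_suml -big_split; apply: ler_sum => i _ /=.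
set s := signed_sum a N i.
have h : 0 <= (`|s| - c) ^+ 2 := sqr_ge0 _.
have s2 : s ^+ 2 = `|s| ^+ 2 by rewrite real_normK ?num_real.
rewrite s2 -subr_ge0; have -> : `|s| ^+ 2 / (2 * c) + c / 2 - `|s| = (`|s| - c) ^+ 2 / (2 * c).
  by field; rewrite gt_eqF.
by rewrite divr_ge0// mulr_ge0// ltW.
Qed.

(** Bessel's inequality: with the values [a n] of a functional of norm at most
    [C] as coefficients, the functional maps the Rademacher sum to [Q N], the
    sum of the squares.  The norm estimate gives [Q N <= Q N / 2 + C ^+ 2 / 2],
    so the values are square summable. *)
Lemma rademacher_weakly_null : weakly_converges_to rademacher 0.
Proof.
move=> phi [C0 hC0]; pose C := 1 + `|C0|; have C_gt0 : 0 < C by rewrite ltr_pwDl.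
have hC F : `|phi F| <= C * `|F|.
  rewrite (le_trans (hC0 F))// ler_wpM2r// (le_trans (ler_norm _))//.
  by rewrite /C lerDr.
pose a n : R := phi (rademacher n).
pose Q n := \sum_(i < n) a i ^+ 2.
have Qle N : Q N <= C ^+ 2.
  have : Q N = phi (\sum_(n < N) a n *: rademacher n).
    by rewrite linear_sum; apply: eq_bigr => i _; rewrite linearZ.
  have := le_trans (hC _) (ler_wpM2l (ltW C_gt0) (sum_rademacher_le a N C_gt0)).
  rewrite mulrDr -/(Q N); set y := phi _.
  have -> : C * (Q N / (2 * C)) = Q N / 2 by field; rewrite gt_eqF.
  move=> h1 h2; have := le_trans (ler_norm (y : R)) h1; rewrite -h2 expr2; lra.
have cQ : cvgn Q.
  apply: nondecreasing_is_cvgn.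
    apply/nondecreasing_seqP => n; rewrite /Q big_ord_recr /= lerDl; exact: sqr_ge0.
  by exists (C ^+ 2) => _ [n _ <-].
have /cvg_seqP cQ' : Q @ \oo --> limn Q by [].
rewrite linear0; apply/cvg_seqP => r r0.
have [|N hN] := cQ' (r ^+ 2 / 2); first by rewrite divr_gt0// exprn_gt0.
exists N => n Nn; rewrite subr0.
have h1 := hN n Nn; have h2 := hN n.+1 (leqW Nn).
have : a n ^+ 2 < r ^+ 2.
  have -> : a n ^+ 2 = (Q n.+1 - limn Q) - (Q n - limn Q).
    by rewrite /Q big_ord_recr /=; ring.
  by rewrite (le_lt_trans (ler_norm _))// (le_lt_trans (ler_normB _ _))// (splitr (r ^+ 2)) ltrD.
rewrite -[a n ^+ 2]real_normK ?num_real//.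
by rewrite ltr_sqr ?nnegrE// ltW.
Qed.

End rademacher_functions.

(** * The subspace spanned by the tree *)

Section tree_operator.
Context {R : realType} {X : completeNormedModType R}.
Variables (C d eps : R) (x dx : nat -> nat -> X).
Hypotheses (C_gt0 : 0 < C) (d_gt0 : 0 < d) (eps_gt0 : 0 < eps).
Hypothesis tree : rademacher_tree C d eps x dx.

Let level n : set X := lspan (2 ^ n) (x n).

Lemma tree_left n i : x n.+1 i.*2 = x n i + dx n i.
Proof. by rewrite (tree_step tree) doubleK odd_double expr0 scale1r. Qed.

Lemma tree_right n i : x n.+1 i.*2.+1 = x n i - dx n i.
Proof.
rewrite (tree_step tree) -[i.*2.+1./2]/(uphalf i.*2) uphalf_double.
by rewrite [odd _]/= odd_double expr1 scaleN1r.
Qed.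

Lemma double_lt n i : (i < 2 ^ n)%N -> (i.*2 < 2 ^ n.+1)%N /\ (i.*2.+1 < 2 ^ n.+1)%N.
Proof. by move=> lti; rewrite expnS mul2n ltn_double -doubleS leq_double. Qed.

Lemma half_scale_add (v : X) : 2^-1 *: (v + v) = v.
Proof. rewrite scalerDr -scalerDl (_ : 2^-1 + 2^-1 = 1 :> R) ?scale1r//; lra. Qed.

Lemma level_sub n : level n `<=` level n.+1.
Proof.
apply: lspan_sub => i /double_lt[l1 l2].
have -> : x n i = 2^-1 *: (x n.+1 i.*2 + x n.+1 i.*2.+1).
  rewrite tree_left tree_right addrACA subrr addr0.
  by rewrite half_scale_add.
by apply: lspanZ; apply: lspanD; exact: lspan_gen.
Qed.

Lemma level_dx n : lspan (2 ^ n) (dx n) `<=` level n.+1.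
Proof.
apply: lspan_sub => i /double_lt[l1 l2].
have -> : dx n i = 2^-1 *: (x n.+1 i.*2 - x n.+1 i.*2.+1).
  rewrite tree_left tree_right opprB addrC addrA subrK.
  by rewrite half_scale_add.
by apply: lspanZ; apply: lspanB; exact: lspan_gen.
Qed.

Lemma level_mono n k : level n `<=` level (n + k).
Proof.
by elim: k => [|k IH]; rewrite ?addn0// addnS; apply: subset_trans IH (@level_sub _).
Qed.

Definition tree_span : set X :=
  [set z | forall r, 0 < r -> exists n y, level n y /\ `|z - y| < r].

Lemma level_tree_span n : level n `<=` tree_span.
Proof. by move=> y Ly r r0; exists n, y; rewrite subrr normr0. Qed.

Lemma tree_span_submod : submod_closed (mem tree_span : {pred X}).
Proof.
split; first by apply/mem_set; apply: (@level_tree_span 0); exact: lspan0.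
move=> a y z /set_mem hy /set_mem hz; apply/mem_set => r r0.
have a0 : 0 < 1 + `|a| by rewrite ltr_pwDl.
have r20 : 0 < r / 2 by rewrite divr_gt0.
have [n [y' [Ly yy']]] := hy _ (divr_gt0 r20 a0).
have [m [z' [Lz zz']]] := hz _ r20.
exists (n + m)%N, (a *: y' + z'); split.
  apply: lspanP; first exact: level_mono.
  by move: (@level_mono m n _ Lz); rewrite addnC.
rewrite opprD addrACA -scalerBr (le_lt_trans (ler_normD _ _))// normrZ (splitr r).
rewrite ler_ltD//; have := ltW yy'; rewrite ler_pdivlMr// => /(le_trans _); apply.
by rewrite mulrC ler_wpM2l// lerDr.
Qed.

Lemma tree_span_closed : closed tree_span.
Proof.
apply/closedP_norm => z hz r r0; have r20 : 0 < r / 2 by rewrite divr_gt0.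
have [y hy zy] := hz _ r20; have [n [y' [Ly yy']]] := hy _ r20.
exists n, y'; split => //; rewrite -[z](subrK y) -addrA.
by rewrite (le_lt_trans (ler_normD _ _))// (splitr r) ltrD.
Qed.

Definition tree_space : closedSubspace X :=
  ClosedSubspace tree_span_submod tree_span_closed.

Local Notation Y := (subspaceType tree_space).

(* The root spans the first summand, and the differences of level [j] span the
   summand of index [j.+1].  Vectors of index at least [block_size j] need not
   lie in the closed span and are replaced by [0] in [blockY]. *)
Let block_size j := if j is n.+1 then (2 ^ n)%N else 1%N.
Let block j : nat -> X := if j is n.+1 then dx n else x 0%N.
Let blockY j i : Y := insubd (0 : Y) (block j i).

Lemma subspace_val_sum (I : Type) (s : seq I) (F : I -> Y) :
  subspace_val (\sum_(i <- s) F i) = \sum_(i <- s) subspace_val (F i).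
Proof. exact: (big_morph (subspace_val (S := tree_space)) (fun _ _ => erefl) erefl). Qed.

Lemma block_level j : lspan (block_size j) (block j) `<=` level j.
Proof. by case: j => [|j] //; exact: level_dx. Qed.

Lemma val_blockY j i : (i < block_size j)%N -> subspace_val (blockY j i) = block j i.
Proof.
move=> lti; rewrite /blockY [LHS]val_insubd ifT//.
by apply/mem_set; apply: (@level_tree_span j); apply: block_level; exact: lspan_gen.
Qed.

Lemma lspan_val j (u : Y) : lspan (block_size j) (blockY j) u ->
  lspan (block_size j) (block j) (subspace_val u).
Proof.
move=> [a ->]; exists a; rewrite subspace_val_sum; apply: eq_bigr => i _.
by rewrite -val_blockY.
Qed.

Lemma lspan_lift j (v : X) : lspan (block_size j) (block j) v ->
  exists2 u : Y, lspan (block_size j) (blockY j) u & subspace_val u = v.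
Proof.
move=> [a ->]; exists (\sum_(i < block_size j) a i *: blockY j i); first by exists a.
rewrite subspace_val_sum; apply: eq_bigr => i _.
by rewrite -val_blockY.
Qed.

Lemma level_decomposition n y : level n y -> exists u : nat -> X,
  (forall j, lspan (block_size j) (block j) (u j)) /\
  y = \sum_(0 <= j < n.+1) u j.
Proof.
elim: n y => [|n IH] y.
  move=> Ly; exists (fun j => if j is 0%N then y else 0); split.
    by case=> // j; exact: lspan0.
  by rewrite big_nat1.
move=> [a ->]; rewrite (big_ord_half (fun i => a i *: x n.+1 i)).
pose y1 := \sum_(i < 2 ^ n) (a i.*2 + a i.*2.+1) *: x n i.
pose y2 := \sum_(i < 2 ^ n) (a i.*2 - a i.*2.+1) *: dx n i.
have [|u [hu y1E]] := IH y1; first by exists (fun i => a i.*2 + a i.*2.+1).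
exists (fun j => if j == n.+1 then y2 else u j); split.
  move=> j; case: eqP => [->|_]; last exact: hu.
  by exists (fun i => a i.*2 - a i.*2.+1).
rewrite big_nat_recr//= eqxx.
have -> : \sum_(0 <= j < n.+1) (if j == n.+1 then y2 else u j) = y1.
  by rewrite y1E !big_nat; apply: eq_bigr => j /andP[_ jn]; rewrite ltn_eqF.
rewrite -big_split; apply: eq_bigr => i _ /=.
rewrite tree_left tree_right scalerDr scalerBr !scalerDl.
by rewrite scaleNr addrACA.
Qed.

(** The first summands add up to the levels of the tree, so the bound on partial
    sums is the almost monotonicity of the tree. *)
Lemma tree_fdd : exists E : nat -> set Y,
  is_fdd E /\ (fdd_constant E <= (1 + eps)%:E)%E.
Proof.
exists (fun j => lspan (block_size j) (blockY j)).
have eps1 : 0 <= 1 + eps by rewrite addr_ge0// ltW.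
apply: fdd_criterion => //.
- move=> u n k hu nk; case: n nk => [_|n nk].
    by rewrite big_geq// normr0 mulr_ge0.
  case: k nk => // k; rewrite ltnS => nk.
  pose v j := subspace_val (u j).
  have hv j : lspan (block_size j) (block j) (v j) by exact: lspan_val.
  have sumE m : `|\sum_(0 <= j < m) u j| = `|\sum_(0 <= j < m) v j|.
    by rewrite -subspace_val_sum.
  rewrite !sumE; have -> : \sum_(0 <= j < k.+1) v j =
    \sum_(0 <= j < n.+1) v j + \sum_(n <= j < k) v j.+1.
    by rewrite (big_cat_nat (leq0n _) (nk : (n.+1 <= k.+1)%N))/= big_add1.
  apply: (tree_monotone tree) => // [|j]; last exact: (hv j.+1).
  rewrite big_nat; apply: lspan_sum => j /andP[_ jn].
  rewrite -(subnKC (jn : (j <= n)%N)); apply: level_mono; exact: block_level.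
- move=> z r r0; have /set_mem hz := subspace_valP z.
  have [n [y [Ly zy]]] := hz r r0; have [v [hv yE]] := level_decomposition Ly.
  have /choice[u uP] : forall j, exists w : Y,
      lspan (block_size j) (blockY j) w /\ subspace_val w = v j.
    by move=> j; have [w hw wv] := lspan_lift (hv j); exists w.
  exists u, n.+1; split; first by move=> j; case: (uP j).
  rewrite [ltLHS](_ : _ = `|subspace_val z - \sum_(0 <= j < n.+1) v j|).
    by rewrite -yE.
  rewrite [LHS](_ : _ = `|subspace_val z - subspace_val (\sum_(0 <= j < n.+1) u j)|)//.
  rewrite subspace_val_sum; congr (`|_ - _|); apply: eq_bigr => j _.
  by case: (uP j).
Qed.

Definition partial_operator n (F : L1 R) : X := \sum_(i < 2 ^ n) coef n i F *: x n i.

Lemma partial_operatorP n a F G : partial_operator n (a *: F + G) =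
  a *: partial_operator n F + partial_operator n G.
Proof.
rewrite scaler_sumr -big_split; apply: eq_bigr => i _ /=.
by rewrite coefP scalerDl scalerA.
Qed.

Lemma partial_operatorB n F G :
  partial_operator n (F - G) = partial_operator n F - partial_operator n G.
Proof. by rewrite addrC -scaleN1r partial_operatorP scaleN1r addrC. Qed.

Lemma partial_operator_le n F : `|partial_operator n F| <= C * `|F|.
Proof.
rewrite (le_trans (ler_norm_sum _ _ _))//.
apply: (@le_trans _ _ (C * \sum_(i < 2 ^ n) `|coef n i F|)); last first.
  by rewrite ler_pM2l// sum_coef_le.
rewrite mulr_sumr; apply: ler_sum => i _; rewrite normrZ mulrC ler_wpM2r//.
exact: (tree_bounded tree).
Qed.

(** The tree is a martingale: replacing a vertex by its two successors does not
    change the value on functions that are constant on its interval. *)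
Lemma partial_operator_stable n k S : lspan (2 ^ n) (dyadcls n) S ->
  partial_operator (n + k) S = partial_operator n S.
Proof.
move=> LS; elim: k => [|k IH]; first by rewrite addn0.
rewrite addnS -IH; set m := (n + k)%N.
have [a ->] : lspan (2 ^ m) (dyadcls m) S by exact: lspan_dyad_refine.
set G := \sum_(i < _) _; rewrite /partial_operator.
rewrite (big_ord_half (fun i => coef m.+1 i G *: x m.+1 i)).
apply: eq_bigr => i _; have [l1 l2] := double_lt (ltn_ord i).
have cE l : (l < 2 ^ m.+1)%N -> coef m.+1 l G = a l./2 * 2 ^- m.+1.
  move=> ltl; have GE : G = \sum_(j < 2 ^ m.+1) a j./2 *: dyadcls m.+1 j.
    rewrite (big_ord_half (fun j => a j./2 *: dyadcls m.+1 j)).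
    apply: eq_bigr => j _.
    rewrite doubleK -[j.*2.+1./2]/(uphalf j.*2) uphalf_double.
    by rewrite -scalerDr dyadcls_half.
  by rewrite GE (coef_step (fun j => a j./2)).
rewrite (coef_half m) !cE// doubleK -[i.*2.+1./2]/(uphalf i.*2) uphalf_double.
rewrite -scalerDr tree_left tree_right addrACA subrr addr0.
by rewrite scalerDr -scalerDl.
Qed.

(** The partial operators are uniformly bounded and eventually constant on
    dyadic step functions, hence converge on all of [L1]. *)
Lemma tree_operator_exists : exists U : {linear L1 R -> Y}, bounded_operator U /\
  forall n S, lspan (2 ^ n) (dyadcls n) S ->
    subspace_val (U S) = partial_operator n S.
Proof.
have cvgU F : exists y : Y, partial_operator ^~ F @ \oo --> subspace_val y.
  have [l Fl] : exists l : X, partial_operator ^~ F @ \oo --> l.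
    apply: cauchy_ex_lim => r r0.
    have [|n [S [LS FS]]] := dyadic_density F (r := r / (2 * C)).
      by rewrite divr_gt0// mulr_gt0.
    have h m : `|partial_operator m (F - S)| < r / 2.
      rewrite (le_lt_trans (partial_operator_le _ _))//.
      have -> : r / 2 = C * (r / (2 * C)) by field; rewrite gt_eqF.
      by rewrite ltr_pM2l.
    exists n => m k nm nk.
    have -> : partial_operator m F - partial_operator k F =
      partial_operator m (F - S) - partial_operator k (F - S).
      rewrite !partial_operatorB -(subnKC nm) -(subnKC nk) !(partial_operator_stable _ LS).
      by rewrite opprB addrA subrK.
    by rewrite (le_lt_trans (ler_normB _ _))// (splitr r) ltrD.
  have Sl : tree_span l.
    apply: (closed_seq_lim tree_span_closed _ Fl) => n.
    by apply: (@level_tree_span n); exists (fun i => coef n i F).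
  by exists (@SubspaceElt _ _ tree_space l (mem_set Sl)).
have [U hU] := choice cvgU.
have Ulin : linear (U : L1 R -> Y).
  move=> a F G; apply: val_inj; apply: (@norm_cvg_unique _ _ _ _ _ _ (hU _)) => /=.
  rewrite (_ : partial_operator ^~ _ = (fun n => a *: partial_operator n F + partial_operator n G)).
    exact: cvgD (cvgZr (hU F)) (hU G).
  by apply/funext => n; exact: partial_operatorP.
pose V : {linear L1 R -> Y} := HB.pack U (GRing.isLinear.Build _ _ _ _ _ Ulin).
exists V; split.
  exists C => F; have := @norm_lim_le _ _ _ _ 0 (C * `|F|) (hU F).
  rewrite sub0r normrN; apply; exists 0%N => n _.
  by rewrite sub0r normrN; exact: partial_operator_le.
move=> n S LS; apply: (@norm_cvg_unique _ _ _ _ _ _ (hU S)).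
apply/cvg_seqP => r r0; exists n => m nm.
by rewrite -(subnKC nm) partial_operator_stable// subrr normr0.
Qed.

Lemma partial_operator_rademacher n :
  partial_operator n.+1 (rademacher n) = 2 ^- n *: \sum_(i < 2 ^ n) dx n i.
Proof.
rewrite /partial_operator (big_ord_half (fun i => coef n.+1 i (rademacher n) *: x n.+1 i)).
rewrite scaler_sumr; apply: eq_bigr => i _; have [l1 l2] := double_lt (ltn_ord i).
rewrite /rademacher !(coef_step (fun j => (-1) ^+ odd j))//.
rewrite odd_double [odd _]/= odd_double expr0 expr1 mul1r mulN1r scaleNr -scalerBr.
rewrite tree_left tree_right opprB addrC addrA subrK.
by rewrite exprS invfM mulrC -scalerA half_scale_add.
Qed.

(** The Rademacher functions are weakly null, but their images lie in distinct
    summands and are bounded below, so that the almost monotonicity keeps them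
    at a positive distance from each other. *)
Lemma tree_space_not_ccp : ~ complete_continuity_property Y.
Proof.
have [U [bU hU]] := tree_operator_exists.
move=> /(_ U bU rademacher 0 rademacher_weakly_null) /cvg_ex[l /cvg_seqP Ul].
have UE n : subspace_val (U (rademacher n)) = 2 ^- n *: \sum_(i < 2 ^ n) dx n i.
  by rewrite (hU n.+1) ?partial_operator_rademacher//; exists (fun i => (-1) ^+ odd i).
have Uspan n : lspan (2 ^ n) (dx n) (subspace_val (U (rademacher n))).
  by rewrite UE; apply: lspanZ; exists (fun=> 1); apply: eq_bigr => i _; rewrite scale1r.
have eps1 : 0 < 1 + eps by rewrite addr_gt0.
have sep n k : (n < k)%N -> d <= (1 + eps) * `|U (rademacher n) - U (rademacher k)|.
  move=> nk; apply: (le_trans (tree_separated tree n)); rewrite -UE.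
  pose z j := if j == k then - subspace_val (U (rademacher k)) else 0.
  have -> : `|U (rademacher n) - U (rademacher k)| =
    `|subspace_val (U (rademacher n)) + \sum_(n.+1 <= j < k.+1) z j|.
    rewrite big_nat_recr//= [X in _ + (X + _)]big_nat_cond big1 ?add0r.
      by rewrite /z eqxx.
    by move=> j /andP[/andP[_ jk] _]; rewrite /z ltn_eqF.
  apply: (tree_monotone tree); first exact: level_dx.
    move=> j; rewrite /z; case: eqP => [->|_]; last exact: lspan0.
    by rewrite -scaleN1r; apply: lspanZ.
  exact: leqW.
have [|N hN] := Ul (d / (2 * (1 + eps))); first by rewrite divr_gt0// mulr_gt0.
have h1 := hN N (leqnn N); have h2 := hN N.+1 (leqnSn N).
have := sep N N.+1 (ltnSn N).
have -> : U (rademacher N) - U (rademacher N.+1) =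
  (U (rademacher N) - l) - (U (rademacher N.+1) - l) by rewrite opprB addrA subrK.
move=> h3; have : d < d; last by rewrite ltxx.
apply: (le_lt_trans h3); rewrite mulrC -ltr_pdivlMr//.
rewrite (le_lt_trans (ler_normB _ _))//.
have -> : d / (1 + eps) = d / (2 * (1 + eps)) + d / (2 * (1 + eps)).
  by field; rewrite gt_eqF.
exact: ltrD.
Qed.

End tree_operator.

Theorem corollary3 (R : realType) (X : completeNormedModType R)
    (failsX : ~ complete_continuity_property X) (eps : R) (eps_gt0 : 0 < eps) :
  exists X0 : closedSubspace X,
    (exists E : nat -> set (subspaceType X0),
        is_fdd E /\ (fdd_constant E <= (1 + eps)%:E)%E) /\
    ~ complete_continuity_property (subspaceType X0).
Proof.
have [A [bA nA]] : exists A : {linear L1 R -> X}, bounded_operator A /\ ~ completely_continuous A.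
  apply: contrapT => H; apply: failsX => A bA; apply: contrapT => nA.
  by apply: H; exists A.
have [C [d [x [dx [C0 d0 tree]]]]] := rademacher_tree_exists eps_gt0 bA nA.
exists (tree_space tree); split.
- exact: tree_fdd.
- exact: tree_space_not_ccp.
Qed.
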